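(* Let $p\ge1$ and let $U^{p}(\Gamma)$ and $U^{p+1}(\Gamma)$ be $H^1$-conforming polynomial bases on the reference triangle $\Gamma$ of degrees $p$ and $p+1$. Let $$\boldsymbol\vartheta^I_1=\begin{bmatrix}\eta\\1-\xi\end{bmatrix},\qquad \boldsymbol\vartheta^I_2=\begin{bmatrix}1-\eta\\ \xi\end{bmatrix},\qquad \boldsymbol\vartheta^I_3=\begin{bmatrix}\eta\\-\xi\end{bmatrix},$$ let $\mathcal N^0_I$ be spanned by $\boldsymbol\vartheta^I_1,\boldsymbol\vartheta^I_2,\boldsymbol\vartheta^I_3$, and let $$\mathcal T_1=\{\boldsymbol\vartheta^I_3\},\quad \mathcal T_2=\{\boldsymbol\vartheta^I_2\},\quad \mathcal T_{12}=\{\boldsymbol\vartheta^I_3-\boldsymbol\vartheta^I_2\},\quad \mathcal T_{13}=\{\boldsymbol\vartheta^I_1+\boldsymbol\vartheta^I_3\},$$ $$\mathcal T_{23}=\{\boldsymbol\vartheta^I_1-\boldsymbol\vartheta^I_2\},\quad \mathcal T_{123}=\{\boldsymbol\vartheta^I_1-\boldsymbol\vartheta^I_2+\boldsymbol\vartheta^I_3\}.$$ Then the finite element $$\mathcal N_I^p=\mathcal N_I^0\oplus\Big\{\bigoplus_{j\in\mathcal J}\nabla\mathcal E_j^{p+1}\Big\}\oplus\nabla\mathcal C_{123}^{p+1}\oplus\Big\{\bigoplus_{i=1}^2\mathcal V^p_i\otimes\mathcal T_i\Big\}\oplus\Big\{\bigoplus_{j\in\mathcal J}\mathcal E^p_j\otimes\mathcal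 T_j\Big\}\oplus\{\mathcal C^p_{123}\otimes\mathcal T_{123}\},$$ with $\mathcal J=\{(1,2),(1,3),(2,3)\}$, is $H(\mathrm{curl})$-conforming under covariant Piola mappings.
   Context: $\Gamma=\{(\xi,\eta)\in[0,1]^2 \mid \xi+\eta\le 1\}$ has vertices $v_1=(0,0)$, $v_2=(0,1)$, $v_3=(1,0)$, edges $e_{12},e_{13},e_{23}$ ($e_{ij}$ joins $v_i$ and $v_j$; its tangent points from the lower to the higher index) and cell $c_{123}$. $P^q(\Gamma)$ denotes the polynomials of total degree at most $q$. $H^1$-conforming polynomial basis $U^q(\Gamma)$ ($q\ge1$): linearly independent polynomials in $P^q(\Gamma)$ with $\dim U^q(\Gamma)=\dim P^q(\Gamma)=(q+2)(q+1)/2$, each associated with one polytope: one vertex base function for each vertex ($\mathcal V^q_i$), $q-1$ edge base functions for each edge ($\mathcal E^q_j$), $(q-2)(q-1)/2$ cell base functions ($\mathcal C^q_{123}$). A vertex base function vanishes at all other vertices and on the non-neighbouring edge; an edge base function vanishes on all other edges; a cell base function vanishes on the boundary. Being $H^1$-conforming means that, after mapping to the elements of a mesh by $n\mapsto n\circ\mathbf x_e^{-1}$ and identifying corresponding base functions of shared vertices and edges, the assembled functions are continuous across element interfaces. $\mathcal S\otimes\mathcal T_\ast$ denotes all products $n\boldsymbol\ell$ with $n\in\mathcal S$, $\boldsymbol\ell\in\mathcal T_\ast$. Association: to an edge $e_{ij}$ belong the function $\boldsymbol\vartheta^I_k$ with non-vanishing tangential trace on $e_{ij}$ and the gradients $\nabla_\xi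 n$, $n\in\mathcal E^{p+1}_{ij}$; all remaining base functions (the tensor products and $\nabla_\xi n$, $n\in\mathcal C^{p+1}_{123}$) belong to the cell. Meshes: $A\subset\mathbb R^2$ is decomposed into a conforming triangulation with elements $A_e=\mathbf x_e(\Gamma)$, with invertible element maps $\mathbf x_e$ (e.g. affine) with Jacobian matrix $\mathbf J_e$, chosen so that the local vertex order agrees on shared edges. The covariant Piola transformation maps a reference field $\boldsymbol\vartheta$ to $\boldsymbol\theta=\mathbf J_e^{-T}\boldsymbol\vartheta\circ\mathbf x_e^{-1}$. $H(\mathrm{curl},A)=\{\mathbf u\in[L^2(A)]^2 \mid u_{2,x}-u_{1,y}\in L^2(A)\}$. ''$H(\mathrm{curl})$-conforming'' means: identifying corresponding mapped base functions of shared edges (and extending cell base functions by zero), the resulting piecewise space is a subspace of $H(\mathrm{curl},A)$, equivalently the jump of the tangential trace $\langle\mathbf t,\mathbf u\rangle$ vanishes on every element interface. *)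

(* Defs.v *)
(* MathComp / MathComp-Analysis, with polynomials from multinomials. *)
From HB Require Import structures.
From mathcomp Require Import all_boot all_order all_algebra.
From mathcomp Require mpoly.
Import -(notations) mpoly.
From mathcomp Require Import all_classical all_reals all_analysis.
Set Implicit Arguments.
Unset Strict Implicit.
Unset Printing Implicit Defensive.
Import Order.TTheory GRing.Theory Num.Theory.
Import numFieldNormedType.Exports.
Local Open Scope classical_set_scope.
Local Open Scope ring_scope.

(* Points are pairs, so that the product Lebesgue measure is available;
   values of vector fields are column vectors, on which Jacobians act. *)
Notation plane R := (R * R)%type.
Notation vfield R := ((R * R)%type -> 'cV[R]_2).

Section Calculus.
Context {R : realType}.

Definition vec2 (a b : R) : 'cV[R]_2 := \col_i [:: a; b]`_i.

Definition vec (z : plane R) : 'cV[R]_2 := vec2 z.1 z.2.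

Definition dot (a b : 'cV[R]_2) : R := \sum_i a i 0 * b i 0.

Definition dx (f : plane R -> R) (z : plane R) : R := 'D_(1, 0) f z.
Definition dy (f : plane R -> R) (z : plane R) : R := 'D_(0, 1) f z.

Definition grad (f : plane R -> R) : vfield R := fun z => vec2 (dx f z) (dy f z).

Definition jacobian2 (x : plane R -> plane R) (z : plane R) : 'M[R]_2 :=
  \matrix_(i, j) vec ('D_([:: (1, 0); (0, 1)]`_j) x z) i 0.

Fixpoint Ck (k : nat) (f : plane R -> R) : Prop :=
  if k is k'.+1 then
    [/\ forall z, derivable f z (1, 0), forall z, derivable f z (0, 1),
        Ck k' (dx f) & Ck k' (dy f)]
  else continuous f.

Definition test_function (A : set (plane R)) (phi : plane R -> R) : Prop :=
  (forall k, Ck k phi) /\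
  exists K : set (plane R),
    [/\ compact K, K `<=` A & forall z, ~ K z -> phi z = 0].

Definition mu2 := (@lebesgue_measure R \x @lebesgue_measure R)%E.

Definition in_L2 (A : set (plane R)) (f : plane R -> R) : Prop :=
  (f \_ A) \in Lfun mu2 2%:E.

(* c is the distributional rotation u_{2,x} - u_{1,y} on the open set A. *)
Definition weak_curl (A : set (plane R)) (u : vfield R) (c : plane R -> R) :=
  forall phi, test_function A phi ->
    \int[mu2]_(z in A) (c z * phi z) =
    \int[mu2]_(z in A) (u z 0 0 * dy phi z - u z 1 0 * dx phi z).

Definition in_Hcurl (A : set (plane R)) (u : vfield R) : Prop :=
  [/\ in_L2 A (fun z => u z 0 0), in_L2 A (fun z => u z 1 0)
    & exists c, in_L2 A c /\ weak_curl A u c].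

End Calculus.

Section ReferenceTriangle.
Context {R : realType}.

Definition Gamma : set (plane R) :=
  [set z | [/\ 0 <= z.1, 0 <= z.2 & z.1 + z.2 <= 1]].

Definition i1 : 'I_3 := @Ordinal 3 0 isT.
Definition i2 : 'I_3 := @Ordinal 3 1 isT.
Definition i3 : 'I_3 := @Ordinal 3 2 isT.

Definition vert (i : 'I_3) : plane R := [:: (0, 0); (0, 1); (1, 0)]`_i.

Definition e12 : 'I_3 := i1.
Definition e13 : 'I_3 := i2.
Definition e23 : 'I_3 := i3.

Definition elo (j : 'I_3) : 'I_3 := tnth [tuple i1; i1; i2] j.
Definition ehi (j : 'I_3) : 'I_3 := tnth [tuple i2; i3; i3] j.

(* Traversed from the lower to the higher vertex index. *)
Definition epar (j : 'I_3) (s : R) : plane R :=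
  (1 - s) *: vert (elo j) + s *: vert (ehi j).

Definition edge (j : 'I_3) : set (plane R) := epar j @` [set s | 0 <= s <= 1].

Definition peval (n : mpoly 2 R) (z : plane R) : R :=
  meval (fun i : 'I_2 => [:: z.1; z.2]`_i) n.

End ReferenceTriangle.

(* In the last clause of mesh_conf the two parametrizations of a common edge
   agree, each running from the lower to the higher local vertex: this is the
   agreement of the local vertex orders and, for maps that are not affine, the
   matching of the curved edges. *)
Record mesh (R : realType) := Mesh {
  nelem : nat;
  emap : 'I_nelem -> plane R -> plane R;
  einv : 'I_nelem -> plane R -> plane R;
  emapK : forall e z, Gamma z -> einv e (emap e z) = z;
  emap_diff : forall e z, Gamma z -> differentiable (emap e) z;
  emap_C1 : forall e, {within Gamma, continuous (jacobian2 (emap e))};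
  emap_unit : forall e z, Gamma z -> jacobian2 (emap e) z \in unitmx;
  mesh_conf : forall e f, e != f ->
    let I := (emap e @` Gamma) `&` (emap f @` Gamma) in
    [\/ I = set0,
        exists i k, I = [set emap e (vert i)] /\
                    emap e (vert i) = emap f (vert k)
      | exists j k, I = emap e @` edge j /\
          forall s, 0 <= s <= 1 -> emap e (epar j s) = emap f (epar k s)] }.

Section OnMesh.
Context {R : realType} (m : mesh R).

Definition elt (e : 'I_(nelem m)) : set (plane R) := emap e @` Gamma.

Definition domain : set (plane R) :=
  interior [set z | exists e, elt e z].

Definition affine_mesh : Prop :=
  forall e : 'I_(nelem m), exists (b : 'cV[R]_2) (B : 'M[R]_2),
    forall z, vec (emap e z) = b + B *m vec z.

Definition same_vertex (e : 'I_(nelem m)) i (f : 'I_(nelem m)) k : bool :=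
  emap e (vert i) == emap f (vert k).

Definition same_edge (e : 'I_(nelem m)) j (f : 'I_(nelem m)) k : bool :=
  `[< emap e @` edge j = emap f @` edge k >].

(* Piecewise functions and fields are families with one branch per element, so
   that both one-sided traces on an interface make sense. *)
Definition continuous_across (w : 'I_(nelem m) -> plane R -> R) : Prop :=
  forall e f z, elt e z -> elt f z -> w e z = w f z.

Definition piola (e : 'I_(nelem m)) (th : vfield R) : vfield R :=
  fun z => (invmx (jacobian2 (emap e) (einv e z)))^T *m th (einv e z).

(* A not necessarily unit tangent of the physical edge. *)
Definition tangent (e : 'I_(nelem m)) (j : 'I_3) (s : R) : 'cV[R]_2 :=
  vec (derive1 (fun r => emap e (epar j r)) s).

Definition no_tangential_jump (u : 'I_(nelem m) -> vfield R) : Prop :=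
  forall e f j k, same_edge e j f k ->
  forall s, 0 <= s <= 1 ->
    dot (tangent e j s) (u e (emap e (epar j s))) =
    dot (tangent e j s) (u f (emap e (epar j s))).

(* The field on the plane; its value on the null set of element boundaries is
   irrelevant. *)
Definition plane_field (u : 'I_(nelem m) -> vfield R) : vfield R :=
  fun z => \sum_e (if `[< interior (elt e) z >] then u e z else 0).

End OnMesh.

Record h1_family (R : realType) (q : nat) := H1Family {
  Vfun : 'I_3 -> mpoly 2 R;
  Efun : 'I_3 -> (q - 1).-tuple (mpoly 2 R);
  Cfun : (((q - 2) * (q - 1))./2).-tuple (mpoly 2 R) }.

Section H1.
Context {R : realType} (q : nat) (U : h1_family R q).

(* At most one index contributes to each sum, since emap is injective. *)
Definition assembled_vertex (m : mesh R) (e : 'I_(nelem m)) (i : 'I_3) :=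
  fun (f : 'I_(nelem m)) (z : plane R) =>
    \sum_(k | same_vertex e i f k) peval (Vfun U k) (einv f z).

Definition assembled_edge (m : mesh R) (e : 'I_(nelem m)) (j : 'I_3) a :=
  fun (f : 'I_(nelem m)) (z : plane R) =>
    \sum_(k | same_edge e j f k) peval (tnth (Efun U k) a) (einv f z).

Definition assembled_cell (m : mesh R) (e : 'I_(nelem m)) b :=
  fun (f : 'I_(nelem m)) (z : plane R) =>
    if f == e then peval (tnth (Cfun U) b) (einv f z) else 0.

(* The dimension of the span is (q + 2)(q + 1)/2 by h1_free. *)
Record h1_basis : Prop := H1Basis {
  h1_degV : forall i, (msize (Vfun U i) <= q.+1)%N;
  h1_degE : forall j a, (msize (tnth (Efun U j) a) <= q.+1)%N;
  h1_degC : forall b, (msize (tnth (Cfun U) b) <= q.+1)%N;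
  h1_free : forall (c : 'I_3 -> R) (d : 'I_3 -> 'I_(q - 1) -> R)
                   (g : 'I_(((q - 2) * (q - 1))./2) -> R),
    \sum_i c i *: Vfun U i + \sum_j \sum_a d j a *: tnth (Efun U j) a
      + \sum_b g b *: tnth (Cfun U) b = 0 ->
    [/\ forall i, c i = 0, forall j a, d j a = 0 & forall b, g b = 0];
  h1_vert_vert : forall i k, k != i -> peval (Vfun U i) (vert k) = 0;
  h1_vert_edge : forall i j, i != elo j -> i != ehi j ->
    forall z, edge j z -> peval (Vfun U i) z = 0;
  h1_edge_edge : forall j a l, l != j ->
    forall z, edge l z -> peval (tnth (Efun U j) a) z = 0;
  h1_cell_edge : forall b l,
    forall z, edge l z -> peval (tnth (Cfun U) b) z = 0;
  h1_cont_vertex : forall m (e : 'I_(nelem m)) i,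
    continuous_across (assembled_vertex e i);
  h1_cont_edge : forall m (e : 'I_(nelem m)) j a,
    continuous_across (assembled_edge e j a);
  h1_cont_cell : forall m (e : 'I_(nelem m)) b,
    continuous_across (assembled_cell e b) }.

End H1.

(* A finite element on Gamma given by its base functions: the a-th functions of
   the three edges correspond to each other. *)
Record edge_element (R : realType) := EdgeElement {
  n_edge : nat;
  edge_fun : 'I_3 -> n_edge.-tuple (vfield R);
  n_cell : nat;
  cell_fun : n_cell.-tuple (vfield R) }.

Section Hcurl.
Context {R : realType} (N : edge_element R).

Definition mapped_edge (m : mesh R) (e : 'I_(nelem m)) (j : 'I_3) a
    : 'I_(nelem m) -> vfield R :=
  fun f z => \sum_(k | same_edge e j f k) piola f (tnth (edge_fun N k) a) z.

Definition mapped_cell (m : mesh R) (e : 'I_(nelem m)) b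
    : 'I_(nelem m) -> vfield R :=
  fun f z => if f == e then piola f (tnth (cell_fun N) b) z else 0.

Definition global_space (m : mesh R) : set ('I_(nelem m) -> vfield R) :=
  [set u | exists (c : 'I_(nelem m) -> 'I_3 -> 'I_(n_edge N) -> R)
                  (d : 'I_(nelem m) -> 'I_(n_cell N) -> R),
    u = \sum_e \sum_j \sum_a c e j a *: mapped_edge e j a
        + \sum_e \sum_b d e b *: mapped_cell e b].
Arguments global_space m : clear implicits.

(* For arbitrary element maps conformity is the absence of tangential jumps;
   on affine triangulations it is moreover the inclusion in H(curl). *)
Definition Hcurl_conforming : Prop :=
  forall m : mesh R,
    (forall u, global_space m u -> no_tangential_jump u) /\
    (affine_mesh m ->
       forall u, global_space m u -> in_Hcurl (domain m) (plane_field u)).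

End Hcurl.

Section Nedelec.
Context {R : realType}.

Definition theta1 : vfield R := fun z => vec2 z.2 (1 - z.1).
Definition theta2 : vfield R := fun z => vec2 (1 - z.2) z.1.
Definition theta3 : vfield R := fun z => vec2 z.2 (- z.1).

Definition T1 : seq (vfield R) := [:: theta3].
Definition T2 : seq (vfield R) := [:: theta2].
Definition T12 : seq (vfield R) := [:: theta3 - theta2].
Definition T13 : seq (vfield R) := [:: theta1 + theta3].
Definition T23 : seq (vfield R) := [:: theta1 - theta2].
Definition T123 : seq (vfield R) := [:: theta1 - theta2 + theta3].

Definition tensor (S : seq (mpoly 2 R)) (T : seq (vfield R)) : seq (vfield R) :=
  [seq (fun z => peval n z *: l z) | n <- S, l <- T].

Definition gradients (S : seq (mpoly 2 R)) : seq (vfield R) :=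
  [seq grad (peval n) | n <- S].

(* The functions of lowest order with nonzero tangential trace on
   e12, e13 and e23, in this order. *)
Definition theta (j : 'I_3) : vfield R :=
  tnth [tuple theta1; theta2; theta3] j.

Context {p : nat} (U : h1_family R p) (U' : h1_family R p.+1).

Definition nedelec_cell : seq (vfield R) :=
  gradients (Cfun U')
  ++ tensor [:: Vfun U i1] T1 ++ tensor [:: Vfun U i2] T2
  ++ tensor (Efun U e12) T12 ++ tensor (Efun U e13) T13
  ++ tensor (Efun U e23) T23
  ++ tensor (Cfun U) T123.

Definition nedelec_I : edge_element R :=
  @EdgeElement R (p.+1 - 1).+1
    (fun j => [tuple of theta j :: [seq grad (peval n) | n <- Efun U' j]])
    (size nedelec_cell) (in_tuple nedelec_cell).

End Nedelec.

(* Main.v *)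
(* On an edge e_j of the reference triangle the tangential trace of theta_k is the
   constant delta_jk, and every function of the cell has zero trace on all edges:
   a gradient because its potential vanishes there, a product because on each edge
   either the scalar or the vector factor does.  The traces of corresponding edge
   gradients agree because the potentials do, by continuity of the assembled H^1
   functions on the very mesh under consideration.  The Piola map preserves
   tangential traces, so the fields of the global space have no tangential jump.

   On an affine mesh, let u be such a field and phi a test function.  On each
   element the integral of curl(phi u) is pulled back to the reference triangle,
   where curl is preserved up to the Jacobian determinant and Fubini with the
   fundamental theorem of calculus gives Green's formula.  There remains a signed
   sum of edge integrals of phi times the tangential trace.  Two elements sharing
   an edge lie on opposite sides of it, so the involution exchanging the two sides
   of an interior edge reverses the signs; edges without a partner do not meet the
   open domain, so phi vanishes on them. *)

Require Import Defs.
From HB Require Import structures.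
From mathcomp Require Import all_boot all_order all_algebra.
From mathcomp Require mpoly.
Import -(notations) mpoly.
From mathcomp Require Import all_classical all_reals all_analysis.
From mathcomp Require Import unstable measurable_realfun.
From mathcomp Require Import ring lra.
Set Implicit Arguments.
Unset Strict Implicit.
Unset Printing Implicit Defensive.
Import Order.TTheory GRing.Theory Num.Theory.
Import numFieldNormedType.Exports.
Local Open Scope classical_set_scope.
Local Open Scope ring_scope.

(** * Continuously differentiable and smooth functions of two variables *)

(** An epsilon bound on the remainder is the little-o expansion that characterizes the differential;
    uniqueness then identifies it with [df]. *)
Lemma is_diff_remainder (K : numFieldType) (V W : normedModType K) (f : V -> W)
    (df : {linear V -> W}) (x : V) : continuous df ->
  (forall e : K, 0 < e ->
     \forall h \near (0 : V), `|f (h + x) - (f x + df h)| <= e * `|h|) ->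
  is_diff x f df.
Proof.
move=> cdf H.
have main : f \o shift x = cst (f x) + (df : V -> W) +o_ (0 : V) id.
  exact/eqaddoP.
split; last exact: (diff_unique cdf main).
by apply/diff_locallyP; rewrite (diff_unique cdf main).
Qed.

Lemma is_derive_affine (K : numFieldType) (V W : normedModType K) (f : V -> W)
    (x v : V) (c : W) :
  (forall h : K, f (h *: v + x) = f x + h *: c) -> is_derive x v f c.
Proof.
move=> H.
have cvgc : (fun h => h^-1 *: ((f \o shift x) (h *: v) - f x)) @ 0^' --> c.
  apply: (@cvg_near_cst _ W); near=> h.
  rewrite /= H [f x + _]addrC addrK scalerA mulVf ?scale1r//.
  by near: h; exact: nbhs_dnbhs_neq.
by split; [exact: (cvgP c)|exact: cvg_lim].
Unshelve. all: by end_near. Qed.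

Section PlaneCalculus.
Context {R : realType}.
Implicit Types (f g : plane R -> R) (z v : plane R).

(** The slice has the same difference quotients as the function along the axis, so that one-variable
    theorems become available for partial derivatives. *)
Lemma derive_slice1 f (x y : R) :
  derivable f (x, y) (1, 0) -> is_derive x 1 (fun t => f (t, y)) (dx f (x, y)).
Proof.
have E : (fun h : R => h^-1 *: (((fun t => f (t, y)) \o shift x) (h *: 1) - f (x, y)))
   = (fun h : R => h^-1 *: ((f \o shift (x, y)) (h *: (1, 0)) - f (x, y))).
  apply/funext => h /=; congr (_ *: (f _ - _)).
  by apply/pair_equal_spec; split=> /=; rewrite ?scaler0 ?add0r.
by move=> df; split; rewrite /derivable /derive ?E //; exact: df.
Qed.

Lemma derive_slice2 f (x y : R) :
  derivable f (x, y) (0, 1) -> is_derive y 1 (fun t => f (x, t)) (dy f (x, y)).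
Proof.
have E : (fun h : R => h^-1 *: (((fun t => f (x, t)) \o shift y) (h *: 1) - f (x, y)))
   = (fun h : R => h^-1 *: ((f \o shift (x, y)) (h *: (0, 1)) - f (x, y))).
  apply/funext => h /=; congr (_ *: (f _ - _)).
  by apply/pair_equal_spec; split=> /=; rewrite ?scaler0 ?add0r.
by move=> df; split; rewrite /derivable /derive ?E //; exact: df.
Qed.

(** The mean value theorem for increments of either sign; the intermediate point is located only by
    its distance from [x], which is what continuity of the derivative calls for. *)
Lemma MVT_shift (g dg : R -> R) (x h : R) :
  (forall t : R, is_derive t 1 g (dg t)) ->
  exists2 c, `|c - x| <= `|h| & g (h + x) - g x = dg c * h.
Proof.
move=> Dg.
have cg (a b : R) : {within `[a, b], continuous g}.
  by apply: derivable_within_continuous => t _; apply: ex_derive.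
have Dg' (a b : R) t : t \in `]a, b[ -> is_derive t 1 g (dg t) by move=> _; exact: Dg.
have [h0|h0] := leP 0 h.
  have xh : x <= h + x by rewrite lerDr.
  have [c cI E] := MVT_segment xh (Dg' _ _) (cg _ _).
  exists c; last by rewrite E addrK.
  move: cI; rewrite in_itv /= => /andP[c1 c2].
  by rewrite !ger0_norm ?subr_ge0// lerBlDr.
have xh : h + x <= x by rewrite gerDr ltW.
have [c cI E] := MVT_segment xh (Dg' _ _) (cg _ _).
exists c; last by rewrite -[LHS]opprB E; ring.
move: cI; rewrite in_itv /= => /andP[c1 c2].
rewrite (ltr0_norm h0) ler0_norm ?subr_le0//; lra.
Qed.

(** Convertible to [Ck 1]. *)
Definition C1 f : Prop :=
  [/\ forall z, derivable f z (1, 0), forall z, derivable f z (0, 1),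
      continuous (dx f) & continuous (dy f)].

(** The increment is split into one along each axis, both evaluated by the mean value theorem;
    continuity of the partial derivatives makes each error at most half of the allowance. *)
Lemma C1_diff f z : C1 f ->
  is_diff z f (fun v => v.1 * dx f z + v.2 * dy f z).
Proof.
case: z => a b [f1 f2 c1 c2]; set z := (a, b).
pose L v := v.1 * dx f z + v.2 * dy f z.
have linL : linear L by move=> k u v; rewrite /L /= /GRing.scale /=; ring.
pose lM := GRing.isLinear.Build _ _ _ _ _ linL.
pose lL : {linear plane R -> R} := HB.pack L lM.
have cL : continuous lL.
  by move=> v; apply: cvgD; apply: cvgMl; [exact: cvg_fst|exact: cvg_snd].
have main (e0 : R) : 0 < e0 ->
    \forall h \near (0 : plane R), `|f (h + z) - (f z + lL h)| <= e0 * `|h|.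
  case/posnumP => e.
  have e2 : 0 < e%:num / 2 by [].
  have /cvgrPdist_le/(_ _ e2)/nbhs_ballP[d1 d10 H1] := c1 z.
  have /cvgrPdist_le/(_ _ e2)/nbhs_ballP[d2 d20 H2] := c2 z.
  near=> h.
  have hd1 : `|h| < d1.
    by near: h; apply/nbhs_ballP; exists d1 => //= y; rewrite -ball_normE/= sub0r normrN.
  have hd2 : `|h| < d2.
    by near: h; apply/nbhs_ballP; exists d2 => //= y; rewrite -ball_normE/= sub0r normrN.
  have n1 : `|h.1| <= `|h| by rewrite prod_normE/= le_max lexx.
  have n2 : `|h.2| <= `|h| by rewrite prod_normE/= le_max lexx orbT.
  have [c hc E1] := @MVT_shift (fun t => f (t, h.2 + b)) (fun t => dx f (t, h.2 + b))
    a h.1 (fun t => derive_slice1 (f1 _)).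
  have [c' hc' E2] := @MVT_shift (fun t => f (a, t)) (fun t => dy f (a, t))
    b h.2 (fun t => derive_slice2 (f2 _)).
  have -> : f (h + (a, b)) - (f (a, b) + lL h) =
    (dx f (c, h.2 + b) - dx f (a, b)) * h.1 + (dy f (a, c') - dy f (a, b)) * h.2.
    have -> : h + z = (h.1 + a, h.2 + b) by [].
    have -> : f (h.1 + a, h.2 + b) = dx f (c, h.2 + b) * h.1 + dy f (a, c') * h.2 + f (a, b).
      by rewrite -E1 -E2; ring.
    by rewrite /= /L /=; ring.
  have B1 : `|dx f (c, h.2 + b) - dx f (a, b)| <= e%:num / 2.
    rewrite distrC; apply: H1; rewrite -ball_normE /= prod_normE /= gt_max.
    rewrite distrC (le_lt_trans hc (le_lt_trans n1 _))//=.
    by rewrite opprD addrCA subrr addr0 normrN (le_lt_trans n2).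
  have B2 : `|dy f (a, c') - dy f (a, b)| <= e%:num / 2.
    rewrite distrC; apply: H2; rewrite -ball_normE /= prod_normE /= gt_max.
    by rewrite subrr normr0 d20 /= distrC (le_lt_trans hc' (le_lt_trans n2 _)).
  rewrite (le_trans (ler_normD _ _))// !normrM.
  rewrite [leRHS](_ : _ = e%:num/2 * `|h| + e%:num/2 * `|h|); last by rewrite /=; field.
  by apply: lerD; apply: ler_pM; rewrite ?normr_ge0 ?B1 ?B2 ?n1 ?n2.
exact: (is_diff_remainder cL main).
Unshelve. all: by end_near. Qed.

Lemma C1_differentiable f z : C1 f -> differentiable f z.
Proof. by move=> /(@C1_diff _ z) ?; apply: ex_diff. Qed.

Lemma C1_continuous f : C1 f -> continuous f.
Proof. by move=> f1 z; apply/differentiable_continuous/C1_differentiable. Qed.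

Lemma C1_derive f z v : C1 f -> 'D_v f z = v.1 * dx f z + v.2 * dy f z.
Proof.
move=> f1; rewrite deriveE; last exact: C1_differentiable.
by have D := C1_diff z f1; rewrite diff_val.
Qed.

Definition smooth f := forall k, Ck k f.

Lemma smooth_C1 f : smooth f -> C1 f.
Proof. by move=> fs; exact: (fs 1%N). Qed.

Lemma smooth_continuous f : smooth f -> continuous f.
Proof. by move=> fs; exact: (fs 0%N). Qed.

Lemma smooth_dx f : smooth f -> smooth (dx f).
Proof. by move=> fs k; have [_ _ ? _] := fs k.+1. Qed.

Lemma smooth_dy f : smooth f -> smooth (dy f).
Proof. by move=> fs k; have [_ _ _ ?] := fs k.+1. Qed.

Lemma dxM f g : C1 f -> C1 g -> dx (f \* g) = (f \* dx g) \+ (g \* dx f).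
Proof. by move=> [f1 ? ? ?] [g1 ? ? ?]; apply/funext => z; exact: deriveM. Qed.

Lemma dyM f g : C1 f -> C1 g -> dy (f \* g) = (f \* dy g) \+ (g \* dy f).
Proof. by move=> [? f2 ? ?] [? g2 ? ?]; apply/funext => z; exact: deriveM. Qed.

Lemma C1M f g : C1 f -> C1 g -> C1 (f \* g).
Proof.
move=> f1 g1; have cf := C1_continuous f1; have cg := C1_continuous g1.
have [a1 a2 a3 a4] := f1; have [b1 b2 b3 b4] := g1.
split=> z.
- exact: derivableM.
- exact: derivableM.
- by rewrite (dxM f1 g1); apply: cvgD; apply: cvgM; [exact: cf|exact: b3|exact: cg|exact: a3].
- by rewrite (dyM f1 g1); apply: cvgD; apply: cvgM; [exact: cf|exact: b4|exact: cg|exact: a4].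
Qed.

Lemma CkD k f g : Ck k f -> Ck k g -> Ck k (f \+ g).
Proof.
elim: k f g => [|k IH] f g /=.
  by move=> cf cg z; apply: cvgD; [exact: cf|exact: cg].
move=> [a1 a2 a3 a4] [b1 b2 b3 b4]; split=> [z|z||].
- exact: derivableD.
- exact: derivableD.
- rewrite (_ : dx _ = dx f \+ dx g); first exact: IH.
  by apply/funext => z; exact: deriveD.
- rewrite (_ : dy _ = dy f \+ dy g); first exact: IH.
  by apply/funext => z; exact: deriveD.
Qed.

Lemma smoothD f g : smooth f -> smooth g -> smooth (f \+ g).
Proof. by move=> fs gs k; apply: CkD; [exact: fs|exact: gs]. Qed.

(** Induction over smooth factors rather than [Ck] ones: the product rule leaves one factor
    undifferentiated, and both factors of each new product are smooth again. *)
Lemma smoothM f g : smooth f -> smooth g -> smooth (f \* g).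
Proof.
move=> fs gs k; elim: k f g fs gs => [|k IH] f g fs gs.
  by move=> z; apply: cvgM; [exact: (smooth_continuous fs)|exact: (smooth_continuous gs)].
have f1 := smooth_C1 fs; have g1 := smooth_C1 gs; have [d1 d2 _ _] := C1M f1 g1.
split; [exact: d1|exact: d2| |].
- by rewrite (dxM f1 g1); apply: CkD; apply: IH => //; exact: smooth_dx.
- by rewrite (dyM f1 g1); apply: CkD; apply: IH => //; exact: smooth_dy.
Qed.

Lemma smooth_cst (c : R) : smooth (cst c).
Proof.
move=> k; elim: k c => [|k IH] c /=; first exact: cst_continuous.
have Ex : dx (cst c) = cst 0 by apply/funext => z; exact: derive_cst.
have Ey : dy (cst c) = cst 0 by apply/funext => z; exact: derive_cst.
split; [move=> z; exact: derivable_cst|move=> z; exact: derivable_cst| |].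
  by rewrite Ex; exact: IH.
by rewrite Ey; exact: IH.
Qed.

Lemma smooth_fst : smooth fst.
Proof.
have E z v : is_derive z v (fst : plane R -> R) v.1.
  by apply: is_derive_affine => h /=; rewrite addrC.
case=> [|k] /=; first by move=> z; exact: cvg_fst.
have Ex : dx (fst : plane R -> R) = cst 1 by apply/funext => z; apply: derive_val.
have Ey : dy (fst : plane R -> R) = cst 0 by apply/funext => z; apply: derive_val.
split; [by move=> z; apply: ex_derive|by move=> z; apply: ex_derive| |].
  by rewrite Ex; exact: smooth_cst.
by rewrite Ey; exact: smooth_cst.
Qed.

Lemma smooth_snd : smooth snd.
Proof.
have E z v : is_derive z v (snd : plane R -> R) v.2.
  by apply: is_derive_affine => h /=; rewrite addrC.
case=> [|k] /=; first by move=> z; exact: cvg_snd.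
have Ex : dx (snd : plane R -> R) = cst 0 by apply/funext => z; apply: derive_val.
have Ey : dy (snd : plane R -> R) = cst 1 by apply/funext => z; apply: derive_val.
split; [by move=> z; apply: ex_derive|by move=> z; apply: ex_derive| |].
  by rewrite Ex; exact: smooth_cst.
by rewrite Ey; exact: smooth_cst.
Qed.

Lemma smooth_sum (I : Type) (r : seq I) (F : I -> plane R -> R) :
  (forall i, smooth (F i)) -> smooth (fun z => \sum_(i <- r) F i z).
Proof.
move=> Fs; elim: r => [|i r IH].
  rewrite (_ : (fun _ => _) = cst 0); first exact: smooth_cst.
  by apply/funext => z; rewrite big_nil.
rewrite (_ : (fun _ => _) = F i \+ (fun z => \sum_(i <- r) F i z)); first exact: smoothD.
by apply/funext => z; rewrite big_cons.
Qed.

Lemma smoothX f n : smooth f -> smooth (fun z => f z ^+ n).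
Proof.
move=> fs; elim: n => [|n IH]; first exact: (smooth_cst 1).
rewrite (_ : (fun _ => _) = f \* (fun z => f z ^+ n)); first exact: smoothM.
by apply/funext => z; rewrite exprS.
Qed.

Lemma smooth_peval (n : mpoly 2 R) : smooth (peval n).
Proof.
have -> : peval n = fun z => \sum_(m <- msupp n) (mcoeff m n * (z.1 ^+ m ord0 * z.2 ^+ m ord_max)).
  apply/funext => z; rewrite /peval /meval /mmap; apply: eq_bigr => m _.
  congr (_ * _); rewrite /mmap1 !big_ord_recl big_ord0 /= mulr1.
  by congr (_ ^+ m _ * _ ^+ m _); apply/val_inj.
apply: smooth_sum => m; apply: (@smoothM (cst _)); first exact: smooth_cst.
by apply: smoothM; apply: smoothX; [exact: smooth_fst|exact: smooth_snd].
Qed.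

End PlaneCalculus.

(** * Measurability and affine change of variables in the plane *)

Section PlaneMeasure.
Context {R : realType}.
Notation mR := (measurableTypeR R).
Notation mu := (@lebesgue_measure R).
Notation muP := (@mu2 R).

(** An open set is a countable union of max-norm balls with rational centre and radius; each ball is
    a product of intervals, hence in the product sigma-algebra. *)
Lemma open_measurable_plane (O : set (plane R)) : open O ->
  measurable (O : set (mR * mR)).
Proof.
move=> oO.
pose B (q : rat * rat * rat) : set (mR * mR) :=
  ball (ratr q.1.1 : R) (ratr q.2) `*` ball (ratr q.1.2 : R) (ratr q.2).
pose D := [set q | B q `<=` O].
have -> : O = \bigcup_q (if q \in D then B q else set0).
  apply/seteqP; split => [[x y] Oxy|z [q _]]; last first.
    by case: ifPn => // /set_mem; exact.
  have /nbhs_ballP[e /= e0 He] := open_nbhs_nbhs (conj oO Oxy).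
  (* With radius below e / 4 and centre within that radius of the point, the rational square
     contains the point and stays within distance e / 2 of it. *)
  have e4 : 0 < e / 4 by rewrite divr_gt0.
  have [r] := @rat_in_itvoo R _ _ e4; rewrite in_itv /= => /andP[r0 r1].
  have [a] := @rat_in_itvoo R (x - ratr r) (x + ratr r) ltac:(lra).
  rewrite in_itv /= => /andP[a1 a2].
  have [b] := @rat_in_itvoo R (y - ratr r) (y + ratr r) ltac:(lra).
  rewrite in_itv /= => /andP[b1 b2].
  exists (a, b, r) => //; rewrite ifT; last first.
    apply/mem_set => -[x' y'] [/= H1 H2]; apply: He.
    move: H1 H2; rewrite -!ball_normE /= !ltr_norml => /andP[? ?] /andP[? ?].
    by rewrite prod_normE /= gt_max !ltr_norml; apply/andP; split; apply/andP; split; lra.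
  by split; rewrite -ball_normE /= ltr_norml; apply/andP; split; lra.
apply: countable_bigcupT_measurable; first exact: countableP.
move=> q; case: ifP => _; last exact: measurable0.
by apply: measurableX; exact: measurable_ball.
Qed.

Lemma continuous_measurable_plane (f : plane R -> R) : continuous f ->
  measurable_fun [set: mR * mR] (f : mR * mR -> mR).
Proof.
move=> /continuousP cf; apply: (measurability _ (RGenOpens.measurableE R)) => _ [_ [a [b ->] <-]].
rewrite setTI; apply: open_measurable_plane; apply: cf.
exact: interval_open.
Qed.

Lemma continuous_measurable_plane2 (h1 h2 : plane R -> R) :
  continuous h1 -> continuous h2 ->
  measurable_fun [set: mR * mR] (fun z => (h1 z, h2 z) : mR * mR).
Proof.
by move=> c1 c2; apply/measurable_fun_pairP; split; exact: continuous_measurable_plane.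
Qed.

Lemma measurable_preimage (h : mR * mR -> mR * mR) (F : set (mR * mR)) :
  measurable_fun setT h -> measurable F -> measurable (h @^-1` F).
Proof. by move=> mh mF; rewrite -[X in measurable X]setTI; exact: mh. Qed.

(** The scaled pushforward agrees with length on half-open intervals, which determines Lebesgue
    measure. *)
Lemma lebesgue_measure_affine (a b : R) (A : set mR) : a != 0 -> measurable A ->
  mu ((fun x => a * x + b) @^-1` A) = (`|a|^-1%:E * mu A)%E.
Proof.
move=> a0 mA; pose h := (fun x => a * x + b) : mR -> mR.
have mh : measurable_fun setT h.
  apply: continuous_measurable_fun => x; apply: cvgD; last exact: cvg_cst.
  by apply: cvgM; [exact: cvg_cst|exact: cvg_id].
have na0 : 0 < `|a| by rewrite normr_gt0.
pose nu := mscale (NngNum (ltW na0)) (pushforward mu h).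
suff -> : mu A = nu mh A.
  by rewrite -[nu mh A]/(`|a|%:E * mu (h @^-1` A))%E muleA -EFinM mulVf ?gt_eqF// mul1e.
rewrite {}/nu; apply: lebesgue_measure_unique => // _ [[p q] _ <-].
rewrite -[RHS]/(`|a|%:E * mu (h @^-1` `]p, q]))%E lebesgue_measure_itv /= lte_fin.
have [ag|al] := ltP 0 a.
  have -> : h @^-1` `]p, q] = `](p - b) / a, (q - b) / a]%classic.
    apply/seteqP; split => x; rewrite /h /= !in_itv /= ltr_pdivrMr// ler_pdivlMr//;
    by move=> /andP[? ?]; apply/andP; split; lra.
  rewrite lebesgue_measure_itv /= lte_fin ltr_pM2r ?invr_gt0// ltrD2r.
  case: ifPn => _; last by rewrite mule0.
  by rewrite gtr0_norm// -!EFinD -EFinM; congr EFin; field.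
(* A negative slope reverses the interval, so its closed end moves to the left; the length is
   unaffected. *)
have {}al : a < 0 by rewrite lt_neqAle a0.
have -> : h @^-1` `]p, q] = `[(q - b) / a, (p - b) / a[%classic.
  apply/seteqP; split => x; rewrite /h /= !in_itv /= ltr_ndivlMr// ler_ndivrMr//;
  by move=> /andP[? ?]; apply/andP; split; lra.
rewrite lebesgue_measure_itv /= lte_fin ltr_nM2r ?invr_lt0// ltrD2r.
case: ifPn => _; last by rewrite mule0.
by rewrite ltr0_norm// -!EFinD -EFinM; congr EFin; field.
Qed.

Lemma measurable_preimage_swap (E : set (mR * mR)) :
  measurable E -> measurable (swap_pair @^-1` E : set (mR * mR)).
Proof.
move=> mE; apply: measurable_preimage mE; apply: continuous_measurable_plane2.
  by move=> z; exact: cvg_snd.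
by move=> z; exact: cvg_fst.
Qed.

Lemma measurable_affine_shear (a b c : R) :
  measurable_fun [set: mR * mR] (fun z => (z.1, a * z.2 + (b * z.1 + c)) : mR * mR).
Proof.
apply: continuous_measurable_plane2 => [z|z]; first exact: cvg_fst.
apply: cvgD; first by apply: cvgM; [exact: cvg_cst|exact: cvg_snd].
apply: cvgD; last exact: cvg_cst.
by apply: cvgM; [exact: cvg_cst|exact: cvg_fst].
Qed.

(** Swapping exchanges the sections in the two directions; the two orders of iteration define the
    same product measure by uniqueness. *)
Lemma mu2_swap (E : set (mR * mR)) : measurable E -> muP (swap_pair @^-1` E) = muP E.
Proof.
move=> mE; rewrite [RHS](_ : _ = (mu \x^ mu)%E E).
  by apply: eq_integral => x _ /=; congr (mu _); apply/seteqP; split=> y;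
    rewrite /xsection /ysection /= !inE.
apply: product_measure_unique => // A B mA mB.
exact: product_measure2E.
Qed.

(** On each vertical line this is a one-dimensional affine map of slope [a], so every section is
    scaled by the same factor. *)
Lemma mu2_shear (a : R) (g : R -> R) (E : set (mR * mR)) : a != 0 -> measurable E ->
  muP ((fun z => (z.1, a * z.2 + g z.1)) @^-1` E) = (`|a|^-1%:E * muP E)%E.
Proof.
move=> a0 mE; rewrite /mu2 /product_measure1.
rewrite -ge0_integralZl//=; last exact: measurable_fun_xsection.
apply: eq_integral => x _ /=.
rewrite -(lebesgue_measure_affine (g x) a0); last exact: measurable_xsection.
by congr (mu _); apply/seteqP; split=> y; rewrite /xsection /= !inE.
Qed.

Definition det2 (u v : plane R) : R := u.1 * v.2 - u.2 * v.1.

Definition affmap (b u v z : plane R) : plane R := b + z.1 *: u + z.2 *: v.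

Lemma continuous_affmap b u v : continuous (affmap b u v).
Proof.
move=> z; apply: cvgD; first apply: cvgD; first exact: cvg_cst.
  by apply: cvgZr_tmp; exact: cvg_fst.
by apply: cvgZr_tmp; exact: cvg_snd.
Qed.

(* An affine map is a composition of shears along the axes and of swaps. *)
Lemma mu2_affmap b u v (E : set (mR * mR)) : det2 u v != 0 -> measurable E ->
  muP (affmap b u v @^-1` E) = (`|det2 u v|^-1%:E * muP E)%E.
Proof.
have main (b1 b2 u1 u2 v1 v2 : R) F : v2 != 0 -> det2 (u1, u2) (v1, v2) != 0 ->
    measurable F -> muP (affmap (b1, b2) (u1, u2) (v1, v2) @^-1` F) =
      (`|det2 (u1, u2) (v1, v2)|^-1%:E * muP F)%E.
  set D := det2 _ _ => v0 D0 mF.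
  (* [S1] produces the second image coordinate; [S2], acting after a swap, expresses the first one
     through it, which requires division by [v2]. *)
  pose S1 := fun z : mR * mR => (z.1, v2 * z.2 + (u2 * z.1 + b2)).
  pose S2 := fun z : mR * mR => (z.1, (D / v2) * z.2 + (v1 / v2 * z.1 + (b1 - v1 * b2 / v2))).
  have -> : affmap (b1, b2) (u1, u2) (v1, v2) = swap_pair \o S2 \o swap_pair \o S1.
    apply/funext => -[x y]; apply/pair_equal_spec.
    by split; rewrite /affmap /S1 /S2 /D /det2 /= /GRing.scale /=; field.
  rewrite !comp_preimage.
  have ms : measurable (swap_pair @^-1` F : set (mR * mR)).
    exact: measurable_preimage_swap mF.
  have mS2 : measurable (S2 @^-1` (swap_pair @^-1` F)).
    exact: measurable_preimage (measurable_affine_shear _ _ _) ms.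
  have Dv0 : D / v2 != 0 by rewrite mulf_neq0 ?invr_eq0.
  rewrite (@mu2_shear v2 (fun x => u2 * x + b2) _ v0); last exact: measurable_preimage_swap.
  rewrite mu2_swap; last exact: mS2.
  rewrite (@mu2_shear _ (fun x => v1 / v2 * x + (b1 - v1 * b2 / v2)) _ Dv0) // mu2_swap //.
  by rewrite muleA -EFinM normrM normfV invfM invrK mulrCA mulVf ?normr_eq0// mulr1.
case: b u v => [b1 b2] [u1 u2] [v1 v2] D0 mE.
(* For [v2] zero the image coordinates are exchanged; the nonzero determinant then forces [v1] to be
   nonzero. *)
have [v0|] := eqVneq v2 0; last by move=> ?; exact: main.
rewrite (_ : affmap _ _ _ = swap_pair \o affmap (b2, b1) (u2, u1) (v2, v1))//.
rewrite comp_preimage.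
have DE : det2 (u2, u1) (v2, v1) = - det2 (u1, u2) (v1, v2) by rewrite /det2 /=; ring.
rewrite main ?DE ?oppr_eq0 ?normrN ?mu2_swap//.
- by apply: contraNneq D0 => v1_0; rewrite /det2 /= v0 v1_0 !mulr0 subrr.
- exact: measurable_preimage_swap mE.
Qed.

End PlaneMeasure.

(** * Integration over the reference triangle *)

Section ReferenceGreen.
Context {R : realType}.
Notation mR := (measurableTypeR R).
Notation mu := (@lebesgue_measure R).
Notation muP := (@mu2 R).

Lemma continuous_pair_comp (f : plane R -> R) (g1 g2 : R -> R) :
  continuous f -> continuous g1 -> continuous g2 ->
  continuous (fun t => f (g1 t, g2 t)).
Proof.
move=> cf c1 c2 t.
apply: (@continuous2_cvg R R R R (nbhs t) _ g1 g2 (fun a b => f (a, b)));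
  [|exact: c1|exact: c2].
rewrite (_ : (fun z : plane R => f (z.1, z.2)) = f); first exact: cf.
by apply/funext => -[].
Qed.

(** The interior of [Gamma], matching the open elements on which [plane_field] is supported. *)
Definition Go : set (plane R) := [set z | [/\ 0 < z.1, 0 < z.2 & z.1 + z.2 < 1]].

Lemma Go_Gamma : Go `<=` Gamma.
Proof. by move=> z [z1 z2 z12]; split; exact: ltW. Qed.

Lemma Go_open : open Go.
Proof.
have c1 : continuous (fst : plane R -> R) by move=> z; exact: cvg_fst.
have c2 : continuous (snd : plane R -> R) by move=> z; exact: cvg_snd.
have -> : Go = (fst @^-1` [set t : R | 0 < t] `&` snd @^-1` [set t : R | 0 < t]) `&`
    (fun z => z.1 + z.2) @^-1` [set t : R | t < 1].
  by apply/seteqP; split => [z [? ? ?]|z [[? ?] ?]].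
apply: openI; first apply: openI.
- by move/continuousP : c1; apply; exact: (@open_gt R 0).
- by move/continuousP : c2; apply; exact: (@open_gt R 0).
- suff /continuousP : continuous (fun z : plane R => z.1 + z.2) by apply; exact: open_lt.
  by move=> z; apply: cvgD; [exact: c1|exact: c2].
Qed.

Lemma Go_measurable : measurable (Go : set (mR * mR)).
Proof. exact: (open_measurable_plane Go_open). Qed.

Lemma mu2_Go_lty : (muP Go < +oo)%E.
Proof.
have mS : measurable (`[0, 1] `*` `[0, 1] : set (mR * mR)) by apply: measurableX.
apply: (@le_lt_trans _ _ (muP (`[0%R, 1%R] `*` `[0%R, 1%R]))).
  apply: le_measure; rewrite ?inE; [exact: Go_measurable|exact: mS|].
  move=> [x y] [/= x0 y0 xy]; split => /=; rewrite in_itv /=; apply/andP; split; lra.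
have -> : muP (`[0%R, 1%R] `*` `[0%R, 1%R]) = (mu `[0%R, 1%R] * mu `[0%R, 1%R])%E.
  exact: product_measure1E.
by rewrite lebesgue_measure_itv /= lte_fin ltr01 -EFinB -EFinM ltry.
Qed.

Lemma bounded_Gamma (h : plane R -> R) : continuous h ->
  exists2 M, 0 <= M & forall z, Gamma z -> `|h z| <= M.
Proof.
move=> ch; pose K := (`[0, 1] `*` `[0, 1] : set (plane R)).
have cK : compact K by apply: compact_setX; exact: segment_compact.
have /compact_bounded[M [_ HM]] : compact (h @` K).
  by apply: continuous_compact => //; exact: continuous_subspaceT.
exists (`|M| + 1); first by rewrite addr_ge0.
move=> [x y] [/= x0 y0 xy]; apply: HM; first by rewrite ltr_pwDr// ler_norm.
exists (x, y) => //; split => /=; rewrite in_itv /=; apply/andP; split; lra.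
Qed.

Lemma Go_integrable (h : plane R -> R) : continuous h ->
  muP.-integrable Go (EFin \o h).
Proof.
move=> ch; apply: measurable_bounded_integrable.
- exact: Go_measurable.
- exact: mu2_Go_lty.
- by apply: measurable_funTS; exact: continuous_measurable_plane.
- have [M M0 HM] := bounded_Gamma ch; exists M; split; first exact: num_real.
  by move=> N MN z Goz; exact: (le_trans (HM _ (Go_Gamma Goz)) (ltW MN)).
Qed.

(** End points are null sets, so the fundamental theorem on the closed interval carries over. *)
Lemma integral_derive (g dg : R -> R) (b : R) : 0 < b ->
  (forall t : R, is_derive t 1 g (dg t)) -> continuous dg ->
  (\int[mu]_(t in `]0%R, b[) (dg t)%:E = (g b - g 0)%:E)%E.
Proof.
move=> b0 Dg cdg.
have cg : continuous g.
  by move=> t; apply/differentiable_continuous/derivable1_diffP; apply: ex_derive.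
have mdg D : measurable_fun (D : set mR) (EFin \o dg).
  apply/measurable_EFinP; apply: measurable_funTS; exact: continuous_measurable_fun.
rewrite integral_itv_obnd_cbnd; last exact: mdg.
rewrite integral_itv_bndo_bndc; last exact: mdg.
rewrite (continuous_FTC2 (F := g) b0).
- by rewrite EFinB.
- exact: continuous_subspaceT.
- split; first by move=> t _; apply: ex_derive.
  + by apply: cvg_at_right_filter; exact: cg.
  + by apply: cvg_at_left_filter; exact: cg.
- by move=> t _; rewrite derive1E; apply: derive_val.
Qed.

(** Fubini reduces the integral to vertical segments from the leg to the hypotenuse, where the
    fundamental theorem applies. *)
Lemma integral_Go_dy (a : plane R -> R) : C1 a ->
  \int[muP]_(z in Go) dy a z = \int[mu]_(t in `]0, 1[) (a (t, 1 - t) - a (t, 0)).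
Proof.
move=> a1; have [_ a2 _ cdy] := a1.
have iG : (mu \x mu)%E.-integrable setT ((EFin \o dy a) \_ Go).
  by apply/(integrable_mkcond _ Go_measurable); exact: Go_integrable.
congr fine; rewrite integral_mkcond -[LHS](integral12_prod_meas1 iG) [RHS]integral_mkcond.
apply: eq_integral => x _; rewrite /fubini_F patchE.
case: ifPn => [/set_mem|/negP xN].
  rewrite /= in_itv /= => /andP[x0 x1].
  rewrite -(integral_derive (dg := fun t => dy a (x, t)) _ (fun t => derive_slice2 (a2 _))).
  - rewrite [RHS]integral_mkcond; apply: eq_integral => y _; rewrite !patchE.
    have -> : ((x, y) \in Go) = (y \in `]0%R, 1 - x[%classic).
      apply/idP/idP => /set_mem H; apply/mem_set.
        by case: H => /= _ y0 xy; rewrite /= in_itv /= y0 /=; lra.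
      by move: H; rewrite /= in_itv /= => /andP[y0 xy]; split=> //=; lra.
    by [].
  - by rewrite subr_gt0.
  - by apply: (continuous_pair_comp cdy) => t; [exact: cvg_cst|exact: cvg_id].
rewrite integral0_eq// => y _; rewrite patchE ifF//.
apply/negP => /set_mem[/= x0 y0 xy]; apply: xN; apply/mem_set; rewrite /= in_itv /= x0 /=; lra.
Qed.

Lemma integral_Go_dx (a : plane R -> R) : C1 a ->
  \int[muP]_(z in Go) dx a z = \int[mu]_(t in `]0, 1[) (a (1 - t, t) - a (0, t)).
Proof.
move=> a1; have [a2 _ cdx _] := a1.
have iG : (mu \x mu)%E.-integrable setT ((EFin \o dx a) \_ Go).
  by apply/(integrable_mkcond _ Go_measurable); exact: Go_integrable.
congr fine; rewrite integral_mkcond -[LHS](integral21_prod_meas1 iG) [RHS]integral_mkcond.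
apply: eq_integral => y _; rewrite /fubini_G patchE.
case: ifPn => [/set_mem|/negP yN].
  rewrite /= in_itv /= => /andP[y0 y1].
  rewrite -(integral_derive (dg := fun t => dx a (t, y)) _ (fun t => derive_slice1 (a2 _))).
  - rewrite [RHS]integral_mkcond; apply: eq_integral => x _; rewrite !patchE.
    have -> : ((x, y) \in Go) = (x \in `]0%R, 1 - y[%classic).
      apply/idP/idP => /set_mem H; apply/mem_set.
        by case: H => /= x0 _ xy; rewrite /= in_itv /= x0 /=; lra.
      by move: H; rewrite /= in_itv /= => /andP[x0 xy]; split=> //=; lra.
    by [].
  - by rewrite subr_gt0.
  - by apply: (continuous_pair_comp cdx) => t; [exact: cvg_id|exact: cvg_cst].
rewrite integral0_eq// => x _; rewrite patchE ifF//.
apply/negP => /set_mem[/= x0 y0 xy]; apply: yN; apply/mem_set; rewrite /= in_itv /= y0 /=; lra.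
Qed.

End ReferenceGreen.

(** * Green's formula on the reference triangle *)

Section AffineIntegral.
Context {R : realType}.
Notation mR := (measurableTypeR R).
Notation mu := (@lebesgue_measure R).
Notation muP := (@mu2 R).

Lemma integrable_unit_itv (g : R -> R) : continuous g ->
  mu.-integrable `]0, 1[ (EFin \o g).
Proof.
move=> cg; apply: (@integrableS _ mR R mu `[0%R, 1%R]%classic) => //.
  exact: subset_itv_oo_cc.
apply: continuous_compact_integrable; first exact: segment_compact.
exact: continuous_subspaceT.
Qed.

Lemma Rintegral_onem (g : R -> R) : continuous g ->
  \int[mu]_(t in `]0, 1[) g (1 - t) = \int[mu]_(t in `]0, 1[) g t.
Proof.
move=> cg.
have cg' : continuous (fun t : R => g (1 - t)).
  move=> t; apply: (@continuous_comp R R R (fun t : R => 1 - t) g); last exact: cg.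
  by apply: cvgB; [exact: cvg_cst|exact: cvg_id].
have toc h : continuous h -> \int[mu]_(t in `]0, 1[) h t = \int[mu]_(t in `[0, 1]) h t.
  move=> ch; congr fine.
  have mh D : measurable_fun (D : set mR) (EFin \o h).
    by apply/measurable_EFinP; apply: measurable_funTS; exact: continuous_measurable_fun.
  by rewrite integral_itv_obnd_cbnd ?integral_itv_bndo_bndc//; exact: mh.
rewrite !toc// [RHS]Rintegration_by_substitution_onem ?ler01 ?lexx//.
  by rewrite onem1.
exact: continuous_subspaceT.
Qed.

(* The sign of an edge, traversed from its lower to its higher vertex, relative
   to the counterclockwise orientation of the boundary. *)
Definition osign (j : 'I_3) : R := [:: -1; 1; -1]`_j.

Definition reftan (j : 'I_3) : plane R := vert (ehi j) - vert (elo j).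

Lemma sum_I3 (F : 'I_3 -> R) : \sum_j F j = F e12 + F e13 + F e23.
Proof.
rewrite !big_ord_recl big_ord0 addr0 addrA.
by congr (F _ + F _ + F _); apply/val_inj.
Qed.

Lemma epar12 (s : R) : epar e12 s = (0, s).
Proof.
rewrite /epar /elo /ehi !(tnth_nth i1) /vert /= /GRing.scale /=.
by congr (_, _); rewrite /= /GRing.scale /=; ring.
Qed.

Lemma epar13 (s : R) : epar e13 s = (s, 0).
Proof.
rewrite /epar /elo /ehi !(tnth_nth i1) /vert /= /GRing.scale /=.
by congr (_, _); rewrite /= /GRing.scale /=; ring.
Qed.

Lemma epar23 (s : R) : epar e23 s = (s, 1 - s).
Proof.
rewrite /epar /elo /ehi !(tnth_nth i1) /vert /= /GRing.scale /=.
by congr (_, _); rewrite /= /GRing.scale /=; ring.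
Qed.

Lemma reftan12 : reftan e12 = (0, 1).
Proof. by rewrite /reftan /elo /ehi !(tnth_nth i1) /vert /= subr0. Qed.

Lemma reftan13 : reftan e13 = (1, 0).
Proof. by rewrite /reftan /elo /ehi !(tnth_nth i1) /vert /= subr0. Qed.

Lemma reftan23 : reftan e23 = (1, -1).
Proof.
by rewrite /reftan /elo /ehi !(tnth_nth i1) /vert; congr (_, _); rewrite /= ?subr0 ?sub0r.
Qed.

(** Each derivative is integrated along its own axis, leaving values on the hypotenuse and on one
    leg; matching these with the edge parametrizations yields the signs. *)
Lemma reference_green (a0 a1 : plane R -> R) : C1 a0 -> C1 a1 ->
  \int[muP]_(z in Go) (dx a1 z - dy a0 z) =
  \sum_j osign j * \int[mu]_(s in `]0, 1[)
    ((reftan j).1 * a0 (epar j s) + (reftan j).2 * a1 (epar j s)).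
Proof.
move=> h0 h1; have c0 := C1_continuous h0; have c1 := C1_continuous h1.
have [_ _ dx1 _] := h1; have [_ _ _ dy0] := h0.
have cid : continuous (fun t : R => t) by move=> t; exact: cvg_id.
have com : continuous (fun t : R => 1 - t).
  by move=> t; apply: cvgB; [exact: cvg_cst|exact: cvg_id].
have cc (c : R) : continuous (fun t : R => c) by move=> t; exact: cvg_cst.
have M : measurable (`]0%R, 1%R[ : set mR) by exact: measurable_itv.
rewrite RintegralB; [|exact: Go_measurable|exact: Go_integrable|exact: Go_integrable].
rewrite (integral_Go_dx h1) (integral_Go_dy h0).
pose I (a : plane R -> R) (g1 g2 : R -> R) := \int[mu]_(t in `]0, 1[) a (g1 t, g2 t).
have split2 (a b : plane R -> R) (g1 g2 g3 g4 : R -> R) :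
    continuous a -> continuous b -> continuous g1 -> continuous g2 -> continuous g3 -> continuous g4 ->
    \int[mu]_(t in `]0, 1[) (a (g1 t, g2 t) - b (g3 t, g4 t)) = I a g1 g2 - I b g3 g4.
  by move=> ca cb g1c g2c g3c g4c; apply: RintegralB => //;
    apply: integrable_unit_itv; exact: continuous_pair_comp.
rewrite (split2 a1 a1 (fun t => 1 - t) id (fun=> 0) id)//.
rewrite (split2 a0 a0 id (fun t => 1 - t) id (fun=> 0))//.
rewrite sum_I3 reftan12 reftan13 reftan23.
have [-> [-> ->]] : osign e12 = -1 /\ osign e13 = 1 /\ osign e23 = -1 by [].
rewrite [X in _ = -1 * X + _ + _](_ : _ = I a1 (fun=> 0) id); last first.
  by apply: eq_Rintegral => s _; rewrite epar12 /=; ring.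
rewrite [X in _ = _ + 1 * X + _](_ : _ = I a0 id (fun=> 0)); last first.
  by apply: eq_Rintegral => s _; rewrite epar13 /=; ring.
rewrite [X in _ = _ + _ + -1 * X](_ : _ =
    I a0 id (fun t => 1 - t) - I a1 id (fun t => 1 - t)); last first.
  rewrite -split2//; apply: eq_Rintegral => s _; rewrite epar23 /=; ring.
(* The horizontal integration meets the hypotenuse as (1 - t, t); reflection turns this into its
   edge parametrization. *)
have -> : I a1 (fun t => 1 - t) id = I a1 id (fun t => 1 - t).
  rewrite /I -(@Rintegral_onem (fun t => a1 (t, 1 - t))).
    by apply: eq_Rintegral => t _; rewrite subKr.
  exact: continuous_pair_comp.
ring.
Qed.

End AffineIntegral.

(** * Integration over an affine image of the reference triangle *)

Section ElementIntegral.
Context {R : realType}.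
Notation mR := (measurableTypeR R).
Notation mu := (@lebesgue_measure R).
Notation muP := (@mu2 R).
Implicit Types (b u v z : plane R).

(* Cramer's rule: the inverse of [affmap b u v]. *)
Definition affinv b u v z : plane R :=
  (det2 (z - b) v / det2 u v, det2 u (z - b) / det2 u v).

Lemma affmapK b u v : det2 u v != 0 -> cancel (affmap b u v) (affinv b u v).
Proof.
case: b u v => [b1 b2] [u1 u2] [v1 v2] D0 [x y].
by move: D0; rewrite /affinv /affmap /det2 /= /GRing.scale /= => D0;
  congr (_, _); field.
Qed.

Lemma affinvK b u v : det2 u v != 0 -> cancel (affinv b u v) (affmap b u v).
Proof.
case: b u v => [b1 b2] [u1 u2] [v1 v2] D0 [x y].
by move: D0; rewrite /affinv /affmap /det2 /= /GRing.scale /= => D0;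
  apply/pair_equal_spec; split; rewrite /= /GRing.scale /=; field.
Qed.

(** The inverse is again affine, with reciprocal determinant, so the results for [affmap] apply to
    it. *)
Lemma affinvE b u v : det2 u v != 0 -> exists b' u' v',
  det2 u' v' = (det2 u v)^-1 /\ affinv b u v = affmap b' u' v'.
Proof.
case: b u v => [b1 b2] [u1 u2] [v1 v2] D0; set D := det2 _ _.
exists (det2 (- (b1, b2)) (v1, v2) / D, det2 (u1, u2) (- (b1, b2)) / D),
  (v2 / D, - u2 / D), (- v1 / D, u1 / D).
split; first by rewrite /D; move: D0; rewrite /det2 /= => D0; field.
apply/funext => -[x y]; rewrite /affinv -/D /affmap /det2 /=.
by apply/pair_equal_spec; split; rewrite /= /GRing.scale /=; field.
Qed.

Lemma continuous_affinv b u v : det2 u v != 0 -> continuous (affinv b u v).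
Proof. by move=> /(@affinvE b _ _)[b' [u' [v' [_ ->]]]]; exact: continuous_affmap. Qed.

(** For a nonzero determinant this is the image of [Go] under [affmap b u v]; as a preimage under
    the inverse it inherits openness and measurability from [Go]. *)
Definition Goimg b u v : set (plane R) := affinv b u v @^-1` Go.

Lemma Goimg_open b u v : det2 u v != 0 -> open (Goimg b u v).
Proof. by move=> /(@continuous_affinv b _ _)/continuousP; apply; exact: Go_open. Qed.

Lemma Goimg_measurable b u v : det2 u v != 0 ->
  measurable (Goimg b u v : set (mR * mR)).
Proof. by move=> D0; exact: (open_measurable_plane (@Goimg_open b _ _ D0)). Qed.

Lemma mu2_affinv b u v (E : set (mR * mR)) : det2 u v != 0 -> measurable E ->
  muP (affinv b u v @^-1` E) = (`|det2 u v|%:E * muP E)%E.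
Proof.
move=> D0 mE; have [b' [u' [v' [DE ->]]]] := @affinvE b _ _ D0.
rewrite mu2_affmap//; first by rewrite DE normfV invrK.
by rewrite DE invr_eq0.
Qed.

Lemma mu2_Goimg_lty b u v : det2 u v != 0 -> (muP (Goimg b u v) < +oo)%E.
Proof.
move=> D0; rewrite mu2_affinv//; last exact: Go_measurable.
by rewrite lte_mul_pinfty ?lee_fin//; exact: mu2_Go_lty.
Qed.

Lemma continuous_comp_affinv b u v (G : plane R -> R) : det2 u v != 0 ->
  continuous G -> continuous (G \o affinv b u v).
Proof.
move=> D0 cG z; apply: continuous_comp; [exact: continuous_affinv|exact: cG].
Qed.

Lemma Goimg_bounded b u v (G : plane R -> R) : continuous G ->
  [bounded G (affinv b u v z) | z in Goimg b u v].
Proof.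
move=> cG; have [M M0 HM] := bounded_Gamma cG; exists M; split; first exact: num_real.
by move=> N MN z Gz; exact: (le_trans (HM _ (Go_Gamma Gz)) (ltW MN)).
Qed.

Lemma Goimg_integrable b u v (G : plane R -> R) : det2 u v != 0 -> continuous G ->
  muP.-integrable (Goimg b u v) (EFin \o (G \o affinv b u v)).
Proof.
move=> D0 cG; apply: measurable_bounded_integrable.
- exact: Goimg_measurable.
- exact: mu2_Goimg_lty.
- by apply: measurable_funTS; apply: continuous_measurable_plane; exact: continuous_comp_affinv.
- exact: Goimg_bounded.
Qed.

(** Pushing the plane measure forward by [affinv b u v] multiplies it by the modulus of the
    determinant; this settles nonnegative functions, and the positive and negative parts of [G] give
    the rest. *)
Lemma integral_Goimg b u v (G : plane R -> R) : det2 u v != 0 -> continuous G ->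
  \int[muP]_(z in Goimg b u v) G (affinv b u v z) =
  `|det2 u v| * \int[muP]_(z in Go) G z.
Proof.
move=> D0 cG.
have mI : measurable_fun [set: mR * mR] (affinv b u v : mR * mR -> mR * mR).
  have ci := @continuous_affinv b _ _ D0.
  apply: (continuous_measurable_plane2 (h1 := fst \o affinv b u v) (h2 := snd \o affinv b u v)).
    by move=> z; apply: continuous_comp; [exact: ci|exact: cvg_fst].
  by move=> z; apply: continuous_comp; [exact: ci|exact: cvg_snd].
have mG : measurable_fun [set: mR * mR] (EFin \o G).
  by apply/measurable_EFinP; exact: continuous_measurable_plane.
have iG := @Goimg_integrable b _ _ _ D0 cG.
have k0 : 0 <= `|det2 u v| by [].
have ig := Go_integrable cG.
have E (f : mR * mR -> \bar R) : measurable_fun setT f -> (forall z, (0 <= f z)%E) ->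
    (\int[muP]_(z in Goimg b u v) f (affinv b u v z) =
     `|det2 u v|%:E * \int[muP]_(z in Go) f z)%E.
  move=> mf f0.
  rewrite -(@ge0_integral_mscale _ _ _ _ _ Go_measurable (NngNum k0))//;
    last exact: measurable_funTS.
  have := @ge0_integral_pushforward _ _ _ _ _ _ mI muP Go f Go_measurable.
  rewrite /comp => <-//; last exact: measurable_funTS.
  apply: eq_measure_integral => A mA _; exact: mu2_affinv.
rewrite /Rintegral integralE [in RHS]integralE.
have -> : (\int[muP]_(z in Goimg b u v) ((fun z => (G (affinv b u v z))%:E)^\+ z) =
   `|det2 u v|%:E * \int[muP]_(z in Go) ((EFin \o G)^\+ z))%E.
  rewrite -(E _ (measurable_funepos mG) (fun z => funepos_ge0 _ z)).
  by apply: eq_integral => z _; rewrite !funeposE.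
have -> : (\int[muP]_(z in Goimg b u v) ((fun z => (G (affinv b u v z))%:E)^\- z) =
   `|det2 u v|%:E * \int[muP]_(z in Go) ((EFin \o G)^\- z))%E.
  rewrite -(E _ (measurable_funeneg mG) (fun z => funeneg_ge0 _ z)).
  by apply: eq_integral => z _; rewrite !funenegE.
have p1 := integrable_pos_fin_num Go_measurable ig.
have p2 := integrable_neg_fin_num Go_measurable ig.
rewrite /comp in p1 p2 *.
by rewrite -(fineK p1) -(fineK p2) -!EFinM -!EFinB /= mulrBr.
Qed.

(** The square is again a continuous function transported to a triangle of finite measure, hence
    integrable. *)
Lemma Goimg_Lfun2 b u v (G : plane R -> R) : det2 u v != 0 -> continuous G ->
  ((G \o affinv b u v) \_ (Goimg b u v)) \in Lfun muP 2%:E.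
Proof.
move=> D0 cG; set f := (_ \_ _).
have mG := @Goimg_measurable b _ _ D0.
have mf : measurable_fun [set: mR * mR] f.
  apply/(measurable_restrictT _ mG); apply: measurable_funTS.
  by apply: continuous_measurable_plane; exact: continuous_comp_affinv.
have i2 : muP.-integrable setT (EFin \o (fun z => f z ^+ 2)).
  rewrite (_ : EFin \o _ = (EFin \o ((fun z => G z ^+ 2) \o affinv b u v)) \_ (Goimg b u v)).
    apply/(integrable_mkcond _ mG); apply: Goimg_integrable => //.
    by move=> z; apply: (@cvgM _ _ _ _ G G _ _ (cG z) (cG z)).
  by apply/funext => z; rewrite /f /= !patchE; case: ifP => // _; rewrite expr0n.
apply/andP; split; first exact/mem_set.
apply/mem_set; rewrite /= /finite_norm unlock /Lnorm.
apply: poweR_lty; have /integrableP[_] := i2; apply: le_lt_trans.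
rewrite le_eqVlt; apply/orP; left; apply/eqP; apply: eq_integral => z _ /=.
by rewrite powR_mulrn ?normr_ge0// normrX.
Qed.

Lemma Rintegral_sum_patch (I : finType) (A : set (mR * mR)) (D : I -> set (mR * mR))
    (F : I -> mR * mR -> R) : measurable A ->
  (forall i, measurable (D i)) -> (forall i, D i `<=` A) ->
  (forall i, muP.-integrable (D i) (EFin \o F i)) ->
  \int[muP]_(z in A) (\sum_i (F i \_ (D i)) z) = \sum_i \int[muP]_(z in D i) F i z.
Proof.
move=> mA mD DA iF.
have iA i : muP.-integrable A (EFin \o (F i \_ (D i))).
  rewrite -restrict_EFin; apply: (integrable_restrict muP (mD i) mA (EFin \o F i)).1.
  by rewrite (setIidr (DA i)).
rewrite /Rintegral.
have -> : (\int[muP]_(z in A) (\sum_i (F i \_ (D i)) z)%:E =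
    \sum_i \int[muP]_(z in A) ((F i \_ (D i)) z)%:E)%E.
  rewrite -(integral_sum mA)//; first by apply: eq_integral => z _; rewrite sumEFin.
rewrite (eq_bigr (fun i => (\int[muP]_(z in D i) F i z)%:E)).
  by rewrite sumEFin.
move=> i _; rewrite /Rintegral fineK; last exact: integrable_fin_num.
rewrite -[in RHS](setIidr (DA i)) integral_mkcondr.
by apply: eq_integral => z _; rewrite restrict_EFin.
Qed.

End ElementIntegral.

(** * Edges and their matching in a mesh *)

Section Edges.
Context {R : realType}.

Lemma I3P (P : 'I_3 -> Prop) : P e12 -> P e13 -> P e23 -> forall j, P j.
Proof.
move=> P1 P2 P3 [[|[|[|//]]] H].
- by rewrite (_ : Ordinal H = e12)//; apply/val_inj.
- by rewrite (_ : Ordinal H = e13)//; apply/val_inj.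
- by rewrite (_ : Ordinal H = e23)//; apply/val_inj.
Qed.

Lemma epar_affine (j : 'I_3) (h s : R) : epar j (h + s) = h *: reftan j + epar j s.
Proof.
rewrite /epar /reftan; apply/pair_equal_spec.
by split; rewrite /= /GRing.scale /=; ring.
Qed.

Lemma epar_edge (j : 'I_3) (s : R) : 0 <= s <= 1 -> edge j (epar j s).
Proof. by move=> s01; exists s. Qed.

Lemma edge_Gamma (j : 'I_3) : @edge R j `<=` Gamma.
Proof.
move=> _ [s /= /andP[s0 s1] <-]; elim/I3P: j; rewrite ?epar12 ?epar13 ?epar23; split=> /=; lra.
Qed.

Lemma edge_Go_disjoint (j : 'I_3) (z : plane R) : edge j z -> ~ Go z.
Proof.
move=> [s /= /andP[s0 s1] <-]; elim/I3P: j; rewrite ?epar12 ?epar13 ?epar23 => -[/=]; lra.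
Qed.

(** The midpoint of an edge lies on no other edge. *)
Lemma edge_sub_inj (j k : 'I_3) : @edge R j `<=` edge k -> j = k.
Proof.
have h01 : 0 <= (2^-1 : R) <= 1 by rewrite invr_ge0 ler0n invf_le1 ?ler1n ?ltr0n.
move=> /(_ _ (epar_edge j h01)) [s /= /andP[s0 s1]].
elim/I3P: j; elim/I3P: k => //; 
  rewrite ?epar12 ?epar13 ?epar23 => /pair_equal_spec[? ?]; exfalso; lra.
Qed.

Lemma edge_inhabited (j : 'I_3) : exists z w : plane R, [/\ edge j z, edge j w & z <> w].
Proof.
exists (epar j 0), (epar j 1); split; try by apply: epar_edge; rewrite ?lexx ler01.
elim/I3P: j; rewrite ?epar12 ?epar13 ?epar23 => /pair_equal_spec[? ?]; lra.
Qed.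

End Edges.

(** Serves to compare two-sided derivatives of functions known to agree on one side only. *)
Lemma dnbhs0_cvg0 (K : realFieldType) (V : normedModType K) (q : K -> V) (l : V) :
  q @ 0^' --> l ->
  (forall d : K, 0 < d -> exists h, [/\ h != 0, `|h| < d & q h = 0]) -> l = 0.
Proof.
move=> ql H; apply/eqP/negPn/negP => l0.
have nl : 0 < `|l| by rewrite normr_gt0.
move/cvgrPdist_lt : ql => /(_ _ nl) /nbhs_ballP[d /= d0 B].
have [h [h0 hd qh]] := H _ d0.
have := B h; rewrite /ball /= sub0r normrN qh subr0 => /(_ hd h0).
by rewrite ltxx.
Qed.

(** Derivability gives the difference quotient of f - g a two-sided limit, which increments of a
    single sign staying in the segment already determine, also at the end points. *)
Lemma derive1_segment_eq (K : realFieldType) (V : normedModType K) (f g : K -> V) (s : K) :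
  0 <= s <= 1 -> derivable f s 1 -> derivable g s 1 ->
  (forall t, 0 <= t <= 1 -> f t = g t) -> derive1 f s = derive1 g s.
Proof.
move=> /andP[s0 s1] df dg fg; rewrite !derive1E; apply/subr0_eq.
rewrite -deriveB//; have := derivableB df dg.
set q := fun h : K => h^-1 *: (((f - g) \o shift s) (h *: 1) - (f - g) s).
move=> /= cq; apply: (@dnbhs0_cvg0 _ _ q); first exact: cq.
have fgs : (f - g) s = 0 by rewrite !fctE fg ?subrr// s0 s1.
(* Stepping right from the left half and left from the right half, by at most 1/2, does not leave
   the segment. *)
move=> d d0; have [s_half|s_half] := leP s (2^-1).
  exists (Num.min (d / 2) 2^-1).
  have m0 : 0 < Num.min (d / 2) 2^-1 by rewrite lt_min; apply/andP; split; lra.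
  split; first by rewrite gt_eqF.
    by rewrite gtr0_norm// gt_min; apply/orP; left; lra.
  rewrite /q fgs /= [_ *: 1]mulr1 !fctE fg ?subrr ?subr0 ?scaler0//.
  apply/andP; split; first lra.
  by have : Num.min (d / 2) 2^-1 <= 2^-1 by [rewrite ge_min lexx orbT]; lra.
exists (- Num.min (d / 2) 2^-1).
have m0 : 0 < Num.min (d / 2) 2^-1 by rewrite lt_min; apply/andP; split; lra.
split; first by rewrite oppr_eq0 gt_eqF.
  by rewrite normrN gtr0_norm// gt_min; apply/orP; left; lra.
rewrite /q fgs /= [_ *: 1]mulr1 !fctE fg ?subrr ?subr0 ?scaler0//.
have : Num.min (d / 2) 2^-1 <= 2^-1 by rewrite ge_min lexx orbT.
by move=> ?; apply/andP; split; lra.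
Qed.

Section MeshGeometry.
Context {R : realType} (m : mesh R).
Implicit Types (e f : 'I_(nelem m)) (j k : 'I_3).

Lemma emap_inj e (z w : plane R) : Gamma z -> Gamma w -> emap e z = emap e w -> z = w.
Proof. by move=> Gz Gw E; rewrite -(emapK e Gz) E emapK. Qed.

Lemma emap_sub_inj e (A B : set (plane R)) : A `<=` Gamma -> B `<=` Gamma ->
  emap e @` A `<=` emap e @` B -> A `<=` B.
Proof.
move=> AG BG AB z Az; have [|w Bw /emap_inj <-//] := AB (emap e z); first by exists z.
- exact: BG.
- exact: AG.
Qed.

Lemma same_edge_self e j k : same_edge e j e k -> j = k.
Proof.
move=> /asboolP E; apply: (@edge_sub_inj R).
by apply: (@emap_sub_inj e); [exact: edge_Gamma|exact: edge_Gamma|rewrite E].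
Qed.

Lemma same_edge_refl e j : same_edge e j e j.
Proof. exact/asboolP. Qed.

Lemma same_edge_sym e j f k : same_edge e j f k = same_edge f k e j.
Proof. by apply/asboolP/asboolP => ->. Qed.

Lemma same_edge_trans e j f k e' j' : same_edge e j f k ->
  same_edge e' j' e j = same_edge e' j' f k.
Proof. by move=> /asboolP E; apply/asboolP/asboolP => ->; rewrite E. Qed.

(** The common part contains an edge, hence two points, which rules out an empty or one-point
    intersection; the edge that remains contains [j] and therefore equals it. *)
Lemma same_edge_meet e j f k : e != f -> same_edge e j f k ->
  (emap e @` Gamma) `&` (emap f @` Gamma) = emap e @` edge j.
Proof.
move=> ef /asboolP E.
have sub : emap e @` edge j `<=` (emap e @` Gamma) `&` (emap f @` Gamma).
  move=> z H; split; last rewrite E in H.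
    by case: H => w /edge_Gamma Gw <-; exists w.
  by case: H => w /edge_Gamma Gw <-; exists w.
have [I0|[i [l [I1 _]]]|[j' [k' [I1 _]]]] := mesh_conf ef.
- have [z [w [Ez _ _]]] := @edge_inhabited R j.
  have : (emap e @` Gamma `&` emap f @` Gamma) (emap e z) by apply: sub; exists z.
  by rewrite I0.
- exfalso; have [z [w [Ez Ew zw]]] := @edge_inhabited R j; apply: zw.
  apply: (@emap_inj e); [exact: edge_Gamma Ez|exact: edge_Gamma Ew|].
  have : (emap e @` Gamma `&` emap f @` Gamma) (emap e z) by apply: sub; exists z.
  have : (emap e @` Gamma `&` emap f @` Gamma) (emap e w) by apply: sub; exists w.
  by rewrite I1 /= => -> ->.
- rewrite I1; congr (_ @` edge _); apply/esym/(@edge_sub_inj R).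
  by apply: (@emap_sub_inj e); [exact: edge_Gamma|exact: edge_Gamma|rewrite -I1].
Qed.

(** Equality of edges as sets is upgraded to equality of parametrizations: once its edges are
    recognized as [j] and [k], this is the last clause of [mesh_conf]. *)
Lemma same_edge_par e j f k s : same_edge e j f k -> 0 <= s <= 1 ->
  emap e (epar j s) = emap f (epar k s).
Proof.
have [->|ef] := eqVneq e f; first by move=> /same_edge_self ->.
move=> E; have EI := same_edge_meet ef E.
have [I0|[i [l [I1 _]]]|[j' [k' [I1 par]]]] := mesh_conf ef.
- exfalso; have [z [w [Ez _ _]]] := @edge_inhabited R j.
  have : (emap e @` edge j) (emap e z) by exists z.
  by rewrite -EI I0.
- exfalso; have [z [w [Ez Ew zw]]] := @edge_inhabited R j; apply: zw.
  apply: (@emap_inj e); [exact: edge_Gamma Ez|exact: edge_Gamma Ew|].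
  have : (emap e @` edge j) (emap e z) by exists z.
  have : (emap e @` edge j) (emap e w) by exists w.
  by rewrite -EI I1 /= => -> ->.
- have jj : j = j'.
    apply: (@edge_sub_inj R); apply: (@emap_sub_inj e); [exact: edge_Gamma|exact: edge_Gamma|].
    by rewrite -EI -I1.
  have kk : k = k'.
    apply: (@edge_sub_inj R); apply: (@emap_sub_inj f); [exact: edge_Gamma|exact: edge_Gamma|].
    move/asboolP : E => <- _ [_ [t t01 <-] <-]; rewrite jj par//.
    by exists (epar k' t) => //; exact: epar_edge.
  by rewrite jj kk; exact: par.
Qed.

End MeshGeometry.

(** * Tangential traces *)

Section VectorAlgebra.
Context {R : realType}.

Lemma dotE (a b : 'cV[R]_2) : dot a b = a 0 0 * b 0 0 + a 1 0 * b 1 0.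
Proof. by rewrite /dot !big_ord_recl big_ord0 addr0; congr (_ + a _ _ * b _ _); apply/val_inj. Qed.

Lemma vec20 (a b : R) : vec2 a b 0 0 = a. Proof. by rewrite mxE. Qed.
Lemma vec21 (a b : R) : vec2 a b 1 0 = b. Proof. by rewrite mxE. Qed.
Definition vec2E := (vec20, vec21).

Lemma vec2_eta (w : 'cV[R]_2) : w = vec2 (w 0 0) (w 1 0).
Proof.
apply/matrixP => i k; rewrite (ord1 k) {k} mxE; case: i => -[|[|//]] H /=;
  by congr (w _ _); apply/val_inj.
Qed.

(** The inverse transpose in the Piola map is dual to the Jacobian acting on tangents; this
    invariance is why tangential traces are preserved. *)
Lemma dot_adjoint (A : 'M[R]_2) (t w : 'cV[R]_2) : A \in unitmx ->
  dot (A *m t) ((invmx A)^T *m w) = dot t w.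
Proof.
move=> uA; have dotM (a b : 'cV[R]_2) : dot a b = (a^T *m b) 0 0.
  by rewrite mxE; apply: eq_bigr => i _; rewrite mxE.
by rewrite !dotM trmx_mul -mulmxA [_ *m (_ *m w)]mulmxA -trmx_mul mulVmx// trmx1 mul1mx.
Qed.

Lemma dotDr (a b c : 'cV[R]_2) : dot a (b + c) = dot a b + dot a c.
Proof. by rewrite !dotE !mxE; ring. Qed.

Lemma dotZr (k : R) (a b : 'cV[R]_2) : dot a (k *: b) = k * dot a b.
Proof. by rewrite !dotE !mxE; ring. Qed.

Lemma dot0r (a : 'cV[R]_2) : dot a 0 = 0.
Proof. by rewrite !dotE !mxE; ring. Qed.

End VectorAlgebra.

Section Tangent.
Context {R : realType}.

Lemma derive1_epar (V : normedModType R) (x : plane R -> V) (j : 'I_3) (s : R) :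
  derive1 (fun r => x (epar j r)) s = 'D_(reftan j) x (epar j s).
Proof.
rewrite /derive1 /derive.
suff -> : (fun h : R => h^-1 *: (x (epar j (h + s)) - x (epar j s))) =
    (fun h => h^-1 *: ((x \o shift (epar j s)) (h *: reftan j) - x (epar j s))) by [].
by apply/funext => h /=; rewrite epar_affine.
Qed.

Lemma derivable_epar (V : normedModType R) (x : plane R -> V) (j : 'I_3) (s : R) :
  derivable x (epar j s) (reftan j) -> derivable (fun r => x (epar j r)) s 1.
Proof.
rewrite /derivable => H.
rewrite (_ : (fun h => _) =
  (fun h => h^-1 *: ((x \o shift (epar j s)) (h *: reftan j) - x (epar j s))))//.
by apply/funext => h /=; rewrite epar_affine [_%:A]mulr1.
Qed.

Lemma jacobian2_mulmx (x : plane R -> plane R) (z v : plane R) : differentiable x z ->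
  jacobian2 x z *m vec v = vec ('D_v x z).
Proof.
move=> dfx.
have E : 'D_v x z = v.1 *: 'D_(1, 0) x z + v.2 *: 'D_(0, 1) x z.
  rewrite !(deriveE _ dfx) -!linearZ -linearD; congr ('d x z _).
  by case: v => a b; apply/pair_equal_spec; split; rewrite /= /GRing.scale /=; ring.
apply/matrixP => i k; rewrite (ord1 k) {k} E !mxE !big_ord_recl big_ord0 addr0 !mxE /=.
move: ('D_(1, 0) x z) ('D_(0, 1) x z) => A B.
by case: i => -[|[|//]] Hi /=; rewrite /GRing.scale /=; ring.
Qed.

Context (m : mesh R).
Implicit Types (e f : 'I_(nelem m)) (j k : 'I_3).

Lemma tangentE e j s : 0 <= s <= 1 ->
  tangent e j s = jacobian2 (emap e) (epar j s) *m vec (reftan j).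
Proof.
move=> s01; have G := edge_Gamma (epar_edge j s01).
by rewrite (jacobian2_mulmx _ (emap_diff e G)) /tangent derive1_epar.
Qed.

(** The parametrizations are known to agree on the closed segment only, while [derive1] looks at
    both sides of an end point; hence the appeal to [derive1_segment_eq]. *)
Lemma tangent_same_edge e j f k s : same_edge e j f k -> 0 <= s <= 1 ->
  tangent e j s = tangent f k s.
Proof.
move=> E s01; rewrite /tangent.
suff -> : derive1 (fun r => emap e (epar j r)) s = derive1 (fun r => emap f (epar k r)) s by [].
apply: (derive1_segment_eq s01).
- by apply/derivable_epar/diff_derivable; apply: emap_diff; exact: edge_Gamma (epar_edge j s01).
- by apply/derivable_epar/diff_derivable; apply: emap_diff; exact: edge_Gamma (epar_edge k s01).
- by move=> t t01; exact: same_edge_par.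
Qed.

Lemma piola_trace e j s (th : vfield R) : 0 <= s <= 1 ->
  dot (tangent e j s) (piola e th (emap e (epar j s))) =
  dot (vec (reftan j)) (th (epar j s)).
Proof.
move=> s01; have G := edge_Gamma (epar_edge j s01).
by rewrite tangentE// /piola emapK// dot_adjoint// emap_unit.
Qed.

End Tangent.

Section ReferenceTraces.
Context {R : realType}.

(** Paired with the edge vector rather than a unit tangent, which spares arc-length factors and lets
    the Piola map preserve it exactly. *)
Definition rtrace (j : 'I_3) (th : vfield R) (s : R) : R :=
  dot (vec (reftan j)) (th (epar j s)).

Lemma rtrace_theta (j k : 'I_3) (s : R) : rtrace j (theta k) s = (j == k)%:R.
Proof.
have t12 : theta e12 = @theta1 R by [].
have t13 : theta e13 = @theta2 R by [].
have t23 : theta e23 = @theta3 R by [].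
rewrite /rtrace dotE /vec; elim/I3P: j; elim/I3P: k;
  rewrite ?reftan12 ?reftan13 ?reftan23 ?epar12 ?epar13 ?epar23 ?t12 ?t13 ?t23
    /theta1 /theta2 /theta3 !vec2E /=; ring.
Qed.

(** Tangential differentiation sees only the restriction of the potential to the edge, so equal or
    vanishing restrictions give equal or vanishing traces. *)
Lemma rtrace_grad (j : 'I_3) (n : mpoly 2 R) (s : R) :
  rtrace j (grad (peval n)) s = derive1 (fun r => peval n (epar j r)) s.
Proof.
rewrite derive1_epar (C1_derive _ _ (smooth_C1 (smooth_peval n))).
by rewrite /rtrace dotE /vec /grad !vec2E.
Qed.

Lemma derivable_peval_epar (j : 'I_3) (n : mpoly 2 R) (s : R) :
  derivable (fun r => peval n (epar j r)) s 1.
Proof.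
apply/derivable_epar/diff_derivable; exact: C1_differentiable (smooth_C1 (smooth_peval n)).
Qed.

Lemma rtrace_grad_eq (j k : 'I_3) (n n' : mpoly 2 R) (s : R) : 0 <= s <= 1 ->
  (forall t, 0 <= t <= 1 -> peval n (epar j t) = peval n' (epar k t)) ->
  rtrace j (grad (peval n)) s = rtrace k (grad (peval n')) s.
Proof.
move=> s01 H; rewrite !rtrace_grad; apply: (derive1_segment_eq s01);
  [exact: derivable_peval_epar|exact: derivable_peval_epar|exact: H].
Qed.

Lemma rtrace_grad0 (j : 'I_3) (n : mpoly 2 R) (s : R) : 0 <= s <= 1 ->
  (forall z, edge j z -> peval n z = 0) -> rtrace j (grad (peval n)) s = 0.
Proof.
move=> s01 H; rewrite rtrace_grad -(derive1_cst (0 : R) s).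
apply: (derive1_segment_eq s01).
- exact: derivable_peval_epar.
- exact: derivable_cst.
- by move=> t t01; apply: H; exact: epar_edge.
Qed.

End ReferenceTraces.

(** * Pullbacks of the fields of the global space *)

Section Admissible.
Context {R : realType} (m : mesh R).
Implicit Types (u : 'I_(nelem m) -> vfield R).

Definition smooth_field (th : vfield R) : Prop :=
  smooth (fun z => th z 0 0) /\ smooth (fun z => th z 1 0).

Lemma smooth_field0 : smooth_field (0 : vfield R).
Proof.
split; rewrite (_ : (fun _ => _) = cst 0).
- exact: smooth_cst.
- by apply/funext => z; rewrite mxE.
- exact: smooth_cst.
- by apply/funext => z; rewrite mxE.
Qed.

Lemma smooth_fieldD (t1 t2 : vfield R) :
  smooth_field t1 -> smooth_field t2 -> smooth_field (t1 + t2).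
Proof.
move=> [a0 a1] [b0 b1]; split.
  rewrite (_ : (fun _ => _) = (fun z => t1 z 0 0) \+ (fun z => t2 z 0 0)); first exact: smoothD.
  by apply/funext => z; rewrite mxE.
rewrite (_ : (fun _ => _) = (fun z => t1 z 1 0) \+ (fun z => t2 z 1 0)); first exact: smoothD.
by apply/funext => z; rewrite mxE.
Qed.

Lemma smooth_fieldM (g : plane R -> R) (t : vfield R) :
  smooth g -> smooth_field t -> smooth_field (fun z => g z *: t z).
Proof.
move=> gs [a0 a1]; split.
  rewrite (_ : (fun _ => _) = g \* (fun z => t z 0 0)); first exact: smoothM.
  by apply/funext => z; rewrite mxE.
rewrite (_ : (fun _ => _) = g \* (fun z => t z 1 0)); first exact: smoothM.
by apply/funext => z; rewrite mxE.
Qed.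

Lemma smooth_fieldZ (c : R) (t : vfield R) : smooth_field t -> smooth_field (c *: t).
Proof. by move=> st; exact: (smooth_fieldM (smooth_cst c) st). Qed.

(* The class of families to which both conclusions apply; [v f] is the
   reference field of which [u f] is the Piola transform. *)
Definition admissible u : Prop := exists v : 'I_(nelem m) -> vfield R,
  [/\ forall f z, u f z = piola f (v f) z,
      forall f, smooth_field (v f) &
      forall f k f' k' s, same_edge f k f' k' -> 0 <= s <= 1 ->
        rtrace k (v f) s = rtrace k' (v f') s].

Lemma rtrace0 (k : 'I_3) (s : R) : rtrace k 0 s = 0.
Proof. exact: dot0r. Qed.

Lemma rtraceD (k : 'I_3) (t1 t2 : vfield R) (s : R) :
  rtrace k (t1 + t2) s = rtrace k t1 s + rtrace k t2 s.
Proof. exact: dotDr. Qed.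

Lemma rtraceZ (k : 'I_3) (c : R) (t : vfield R) (s : R) :
  rtrace k (c *: t) s = c * rtrace k t s.
Proof. exact: dotZr. Qed.

Lemma piola0 (f : 'I_(nelem m)) z : piola f 0 z = 0.
Proof. exact: mulmx0. Qed.

Lemma piolaD (f : 'I_(nelem m)) (t1 t2 : vfield R) z :
  piola f (t1 + t2) z = piola f t1 z + piola f t2 z.
Proof. exact: mulmxDr. Qed.

Lemma piolaZ (f : 'I_(nelem m)) (c : R) (t : vfield R) z :
  piola f (c *: t) z = c *: piola f t z.
Proof. by rewrite /piola scalemxAr. Qed.

Lemma admissible0 : admissible 0.
Proof.
exists (fun=> 0); split.
- by move=> f z; rewrite piola0.
- by move=> f; exact: smooth_field0.
- by move=> *; rewrite !rtrace0.
Qed.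

Lemma admissibleD u1 u2 : admissible u1 -> admissible u2 -> admissible (u1 + u2).
Proof.
move=> [v1 [E1 S1 T1]] [v2 [E2 S2 T2]]; exists (fun f => v1 f + v2 f); split.
- by move=> f z; rewrite piolaD -E1 -E2.
- by move=> f; exact: smooth_fieldD.
- move=> f k f' k' s E s01; by rewrite !rtraceD (T1 _ _ _ _ _ E s01) (T2 _ _ _ _ _ E s01).
Qed.

Lemma admissibleZ (c : R) u : admissible u -> admissible (c *: u).
Proof.
move=> [v [E S T]]; exists (fun f => c *: v f); split.
- by move=> f z; rewrite piolaZ -E.
- by move=> f; exact: smooth_fieldZ.
- move=> f k f' k' s ff s01; by rewrite !rtraceZ (T _ _ _ _ _ ff s01).
Qed.

Lemma admissible_no_jump u : admissible u -> no_tangential_jump u.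
Proof.
(* Only the point in the second field is moved to the parametrization of [f], so that each trace is
   computed in its own element. *)
move=> [v [E S T]] e f j k ef s s01; rewrite {2}(same_edge_par ef s01) !E.
rewrite piola_trace// (tangent_same_edge ef s01) piola_trace//.
exact: T.
Qed.

End Admissible.

(** * Traces of the base functions of the Nedelec element *)

Section NedelecAdmissible.
Context {R : realType} {p : nat} (U : h1_family R p) (U' : h1_family R p.+1).
Hypothesis (hU : h1_basis U) (hU' : h1_basis U').
Let N := nedelec_I U U'.

Lemma smooth_vec2 (f g : plane R -> R) : smooth f -> smooth g ->
  smooth_field (fun z => vec2 (f z) (g z)).
Proof.
move=> fs gs; split.
  by rewrite (_ : (fun _ => _) = f)//; apply/funext => z; rewrite vec2E.
by rewrite (_ : (fun _ => _) = g)//; apply/funext => z; rewrite vec2E.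
Qed.

Lemma smooth_theta (j : 'I_3) : smooth_field (@theta R j).
Proof.
have s1 := @smooth_fst R; have s2 := @smooth_snd R.
have sN (f : plane R -> R) : smooth f -> smooth (fun z => - f z).
  move=> fs; rewrite (_ : (fun _ => _) = cst (-1) \* f).
    exact: smoothM (smooth_cst _) fs.
  by apply/funext => z /=; rewrite mulN1r.
have s1N := sN _ s1; have s2N := sN _ s2.
elim/I3P: j.
- exact: (smooth_vec2 s2 (smoothD (smooth_cst 1) s1N)).
- exact: (smooth_vec2 (smoothD (smooth_cst 1) s2N) s1).
- exact: (smooth_vec2 s2 s1N).
Qed.

Lemma smooth_grad (n : mpoly 2 R) : smooth_field (grad (peval n)).
Proof.
have sn := smooth_peval n.
exact: (smooth_vec2 (smooth_dx sn) (smooth_dy sn)).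
Qed.

Lemma edge_fun0 (j : 'I_3) : tnth (edge_fun N j) ord0 = theta j.
Proof. by []. Qed.

Lemma edge_funS (j : 'I_3) (a : 'I_(p.+1 - 1)) :
  tnth (edge_fun N j) (lift ord0 a) = grad (peval (tnth (Efun U' j) a)).
Proof. by rewrite tnthS tnth_map. Qed.

Lemma edge_fun_smooth j a : smooth_field (tnth (edge_fun N j) a).
Proof.
case: (unliftP ord0 a) => [b|] ->; last exact: smooth_theta.
by rewrite edge_funS; exact: smooth_grad.
Qed.

Lemma edge_fun_other j k a (s : R) : k != j -> 0 <= s <= 1 ->
  rtrace k (tnth (edge_fun N j) a) s = 0.
Proof.
move=> kj s01; case: (unliftP ord0 a) => [b|] ->.
  rewrite edge_funS rtrace_grad0// => z; exact: (h1_edge_edge hU').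
by rewrite edge_fun0 rtrace_theta (negPf kj).
Qed.

(** Two edges of one element with the same image are equal, so a single summand survives. *)
Lemma assembled_edge_par (m : mesh R) (e f : 'I_(nelem m)) j a k (s : R) :
  same_edge e j f k -> 0 <= s <= 1 ->
  assembled_edge U' e j a f (emap f (epar k s)) = peval (tnth (Efun U' k) a) (epar k s).
Proof.
move=> E s01; rewrite /assembled_edge emapK; last exact: edge_Gamma (epar_edge k s01).
rewrite (bigD1 k)//= big1 ?addr0// => l /andP[El lk].
have : same_edge f l f k by rewrite -(same_edge_trans f l E) same_edge_sym.
by move/same_edge_self => lk'; rewrite lk' eqxx in lk.
Qed.

Lemma edge_fun_match (m : mesh R) (e f : 'I_(nelem m)) j k a (s : R) :
  same_edge e j f k -> 0 <= s <= 1 ->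
  rtrace j (tnth (edge_fun N j) a) s = rtrace k (tnth (edge_fun N k) a) s.
Proof.
move=> E s01; case: (unliftP ord0 a) => [b|] ->; last first.
  by rewrite !edge_fun0 !rtrace_theta !eqxx.
rewrite !edge_funS; apply: rtrace_grad_eq => // t t01.
(* Both potentials become branches of the single function assembled from edge [j] of [e], evaluated
   at a common point of the two elements. *)
rewrite -(assembled_edge_par b (same_edge_refl e j) t01).
rewrite -(assembled_edge_par b E t01) -(same_edge_par E t01).
apply: (h1_cont_edge hU').
  by exists (epar j t) => //; exact: edge_Gamma (epar_edge j t01).
rewrite (same_edge_par E t01).
by exists (epar k t) => //; exact: edge_Gamma (epar_edge k t01).
Qed.

(** Zero trace on the whole boundary is what lets extension by zero create no tangential jump. *)
Definition cell_like (th : vfield R) : Prop :=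
  smooth_field th /\ forall j s, 0 <= s <= 1 -> rtrace j th s = 0.

Lemma cell_like_tensor (S : seq (mpoly 2 R)) (l : vfield R) th :
  smooth_field l ->
  (forall n j s, n \in S -> 0 <= s <= 1 -> peval n (epar j s) * rtrace j l s = 0) ->
  th \in tensor S [:: l] -> cell_like th.
Proof.
move=> ls H /allpairsP[[n l'] [/= nS]]; rewrite inE => /eqP -> ->; split.
  exact: smooth_fieldM (smooth_peval n) ls.
move=> j s s01; rewrite -[LHS]/(dot _ (_ *: _)) dotZr; exact: H.
Qed.

(** [theta3] and [theta2] have trace only on the edge opposite to the first and second vertex
    respectively, where the vertex function vanishes. The fields multiplying edge functions have no
    trace on the one edge where the scalar factor may be nonzero. *)
Lemma cell_like_nedelec th : th \in nedelec_cell U U' -> cell_like th.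
Proof.
have st1 := smooth_theta i1; have st2 := smooth_theta i2; have st3 := smooth_theta i3.
have rt1 := @rtrace_theta R ^~ i1; have rt2 := @rtrace_theta R ^~ i2.
have rt3 := @rtrace_theta R ^~ i3.
rewrite -[theta i1]/theta1 in st1 rt1 *; rewrite -[theta i2]/theta2 in st2 rt2 *.
rewrite -[theta i3]/theta3 in st3 rt3 *.
have stN (t : vfield R) : smooth_field t -> smooth_field (- t).
  by move=> ts; rewrite -scaleN1r; exact: smooth_fieldZ.
have rtN j (t : vfield R) s : rtrace j (- t) s = - rtrace j t s.
  by rewrite -scaleN1r rtraceZ mulN1r.
rewrite /nedelec_cell.
rewrite mem_cat => /orP[|].
  move=> /mapP[n /tnthP[b ->] ->]; split; first exact: smooth_grad.
  by move=> j s s01; apply: rtrace_grad0 => // z; exact: (h1_cell_edge hU').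
rewrite mem_cat => /orP[|].
  apply: (@cell_like_tensor _ theta3) => // n j s; rewrite inE => /eqP -> s01.
  rewrite rt3; have [->|_] := eqVneq j i3; last by rewrite mulr0.
  by rewrite (h1_vert_edge hU (i := i1) (j := i3) isT isT (epar_edge i3 s01)) mul0r.
rewrite mem_cat => /orP[|].
  apply: (@cell_like_tensor _ theta2) => // n j s; rewrite inE => /eqP -> s01.
  rewrite rt2; have [->|_] := eqVneq j i2; last by rewrite mulr0.
  by rewrite (h1_vert_edge hU (i := i2) (j := i2) isT isT (epar_edge i2 s01)) mul0r.
rewrite mem_cat => /orP[|].
  apply: (@cell_like_tensor _ (theta3 - theta2)); first by apply: smooth_fieldD => //; exact: stN.
  move=> n j s /tnthP[a ->] s01; rewrite rtraceD rtN rt3 rt2.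
  have [->|ne] := eqVneq j e12; first by rewrite subrr mulr0.
  by rewrite (h1_edge_edge hU a ne (epar_edge j s01)) mul0r.
rewrite mem_cat => /orP[|].
  apply: (@cell_like_tensor _ (theta1 + theta3)); first exact: smooth_fieldD.
  move=> n j s /tnthP[a ->] s01; rewrite rtraceD rt1 rt3.
  have [->|ne] := eqVneq j e13; first by rewrite addr0 mulr0.
  by rewrite (h1_edge_edge hU a ne (epar_edge j s01)) mul0r.
rewrite mem_cat => /orP[|].
  apply: (@cell_like_tensor _ (theta1 - theta2)); first by apply: smooth_fieldD => //; exact: stN.
  move=> n j s /tnthP[a ->] s01; rewrite rtraceD rtN rt1 rt2.
  have [->|ne] := eqVneq j e23; first by rewrite subrr mulr0.
  by rewrite (h1_edge_edge hU a ne (epar_edge j s01)) mul0r.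
apply: (@cell_like_tensor _ (theta1 - theta2 + theta3)).
  by apply: smooth_fieldD => //; apply: smooth_fieldD => //; exact: stN.
move=> n j s /tnthP[b ->] s01.
by rewrite (h1_cell_edge hU b (epar_edge j s01)) mul0r.
Qed.

Context (m : mesh R).

Lemma admissible_edge (e : 'I_(nelem m)) j a : admissible (mapped_edge (N := N) e j a).
Proof.
(* At most one summand is present on each element; edges that coincide physically are selected
   together, so their traces match. *)
pose v (f : 'I_(nelem m)) : vfield R :=
  \sum_(k | same_edge e j f k) tnth (edge_fun N k) a.
have Tv f k s : 0 <= s <= 1 -> rtrace k (v f) s =
    if same_edge e j f k then rtrace k (tnth (edge_fun N k) a) s else 0.
  move=> s01.
  have -> : rtrace k (v f) s = \sum_(l | same_edge e j f l) rtrace k (tnth (edge_fun N l) a) s.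
    rewrite /v; elim/big_rec2: _ => [|l x y _ <-]; first exact: rtrace0.
    by rewrite rtraceD.
  case: ifPn => E; last first.
    apply: big1 => l El; apply: edge_fun_other => //.
    by apply: contraNneq E => ->.
  rewrite (bigD1 k)//= big1 ?addr0// => l /andP[_ lk].
  by apply: edge_fun_other => //; rewrite eq_sym.
exists v; split.
- move=> f z; rewrite /mapped_edge /v; elim/big_rec2: _ => [|l x y _ ->]; first by rewrite piola0.
  by rewrite piolaD.
- move=> f; apply: big_ind => [|t1 t2|k _]; [exact: smooth_field0|exact: smooth_fieldD|].
  exact: edge_fun_smooth.
- move=> f k f' k' s E s01; rewrite !Tv// (same_edge_trans _ _ E).
  by case: ifP => // _; exact: edge_fun_match E s01.
Qed.

Lemma admissible_cell (e : 'I_(nelem m)) b : admissible (mapped_cell (N := N) e b).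
Proof.
have [st tr] : cell_like (tnth (cell_fun N) b).
  by apply: cell_like_nedelec; rewrite (tnth_nth 0) /= mem_nth.
pose v (f : 'I_(nelem m)) : vfield R := if f == e then tnth (cell_fun N) b else 0.
have Tv f k s : 0 <= s <= 1 -> rtrace k (v f) s = 0.
  by move=> s01; rewrite /v; case: ifP => _; [exact: tr|exact: rtrace0].
exists v; split.
- by move=> f z; rewrite /mapped_cell /v; case: ifP => _ //; rewrite piola0.
- by move=> f; rewrite /v; case: ifP => _; [exact: st|exact: smooth_field0].
- by move=> f k f' k' s _ s01; rewrite !Tv.
Qed.

Lemma admissible_global u : @global_space R N m u -> admissible u.
Proof.
move=> [c [d ->]]; apply: admissibleD.
  apply: big_ind => [|u1 u2|e _]; [exact: admissible0|exact: admissibleD|].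
  apply: big_ind => [|u1 u2|j _]; [exact: admissible0|exact: admissibleD|].
  apply: big_ind => [|u1 u2|a _]; [exact: admissible0|exact: admissibleD|].
  exact/admissibleZ/admissible_edge.
apply: big_ind => [|u1 u2|e _]; [exact: admissible0|exact: admissibleD|].
apply: big_ind => [|u1 u2|b _]; [exact: admissible0|exact: admissibleD|].
exact/admissibleZ/admissible_cell.
Qed.

End NedelecAdmissible.

(** * Geometry of affine meshes *)

Section AffineMesh.
Context {R : realType} (m : mesh R).
Hypothesis haff : affine_mesh m.
Implicit Types (e f : 'I_(nelem m)) (j k : 'I_3).

(** Base point, edge vectors and signed Jacobian determinant of the affine element map, read off
    from the images of the vertices. *)
Definition eb e : plane R := emap e (0, 0).
Definition eu e : plane R := emap e (1, 0) - emap e (0, 0).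
Definition ev e : plane R := emap e (0, 1) - emap e (0, 0).
Definition edet e : R := det2 (eu e) (ev e).
Notation inve e := (affinv (eb e) (eu e) (ev e)).
Notation img e := (Goimg (eb e) (eu e) (ev e)).

Lemma emap_affmap e : emap e = affmap (eb e) (eu e) (ev e).
Proof.
have [b [B E]] := haff e.
have E1 z : (emap e z).1 = b 0 0 + B 0 0 * z.1 + B 0 1 * z.2.
  have := congr1 (fun w : 'cV[R]_2 => w 0 0) (E z).
  rewrite /vec vec20 => ->; rewrite !mxE !big_ord_recl big_ord0 !mxE /= addr0 addrA.
  by congr (_ + B _ _ * _ + B _ _ * _); apply/val_inj.
have E2 z : (emap e z).2 = b 1 0 + B 1 0 * z.1 + B 1 1 * z.2.
  have := congr1 (fun w : 'cV[R]_2 => w 1 0) (E z).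
  rewrite /vec vec21 => ->; rewrite !mxE !big_ord_recl big_ord0 !mxE /= addr0 addrA.
  by congr (_ + B _ _ * _ + B _ _ * _); apply/val_inj.
apply/funext => z; rewrite /eb /eu /ev /affmap [LHS]surjective_pairing.
by apply/pair_equal_spec; split; rewrite /= /GRing.scale /= ?E1 ?E2 /=; ring.
Qed.

Lemma derive_emap e z w : 'D_w (emap e) z = w.1 *: eu e + w.2 *: ev e.
Proof.
have D : is_derive z w (emap e) (w.1 *: eu e + w.2 *: ev e).
  apply: is_derive_affine => h; rewrite emap_affmap /affmap.
  by apply/pair_equal_spec; split; rewrite /= /GRing.scale /=; ring.
exact: derive_val.
Qed.

Lemma Gamma00 : Gamma (0, 0 : R).
Proof. by split => /=; lra. Qed.

Lemma jacobian_mulmx e z w : Gamma z ->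
  jacobian2 (emap e) z *m vec w = vec (w.1 *: eu e + w.2 *: ev e).
Proof.
by move=> Gz; rewrite (jacobian2_mulmx _ (emap_diff e Gz)) derive_emap.
Qed.

Lemma edet_neq0 e : edet e != 0.
Proof.
apply/eqP => D0; have U := emap_unit e Gamma00.
have inj w : w.1 *: eu e + w.2 *: ev e = 0 -> w = 0.
  move=> H; have := jacobian_mulmx e w Gamma00; rewrite H.
  move=> /(congr1 (mulmx (invmx (jacobian2 (emap e) (0, 0))))).
  rewrite mulKmx// => E; rewrite [w]surjective_pairing.
  have E0 := congr1 (fun w : 'cV[R]_2 => w 0 0) E; have E1 := congr1 (fun w : 'cV[R]_2 => w 1 0) E.
  have z0 : vec (0 : plane R) = 0 by rewrite /vec /= [RHS]vec2_eta !mxE.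
  move: E0 E1; rewrite z0 mulmx0 /vec /= vec20 vec21 !mxE => -> ->.
  by [].
move: D0 inj; rewrite /edet /det2; case: (eu e) (ev e) => u1 u2 [v1 v2] /= D0 inj.
(* A singular matrix annihilates this vector and the next one; injectivity then makes all entries
   zero, and (1, 0) would be annihilated too. *)
have H1 : (v1, - u1) = 0 :> plane R.
  by apply: inj; apply/pair_equal_spec; split; rewrite /= /GRing.scale /=; lra.
have H2 : (v2, - u2) = 0 :> plane R.
  by apply: inj; apply/pair_equal_spec; split; rewrite /= /GRing.scale /=; lra.
move: H1 H2 => /pair_equal_spec[v10 u10] /pair_equal_spec[v20 u20].
have /pair_equal_spec[/= one0 _] : (1, 0) = 0 :> plane R.
  by apply: inj; apply/pair_equal_spec; split; rewrite /= /GRing.scale /=; lra.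
by move/eqP: one0; rewrite oner_eq0.
Qed.

Lemma affinv_emapK e z : inve e (emap e z) = z.
Proof. by rewrite emap_affmap affmapK//; exact: edet_neq0. Qed.

Lemma emap_affinvK e z : emap e (inve e z) = z.
Proof. by rewrite emap_affmap affinvK//; exact: edet_neq0. Qed.

(** [einv] is prescribed only on the element, whereas the affine inverse is explicit on the whole
    plane. *)
Lemma einv_img e z : img e z -> einv e z = inve e z.
Proof. by move=> /Go_Gamma G; rewrite -{1}(emap_affinvK e z) emapK. Qed.

Lemma img_open e : open (img e).
Proof. exact: (@Goimg_open _ (eb e) _ _ (edet_neq0 e)). Qed.

Lemma img_elt e : img e `<=` elt e.
Proof. by move=> z /Go_Gamma G; exists (inve e z) => //; rewrite emap_affinvK. Qed.

Lemma interior_Gamma (z : plane R) : (interior Gamma) z -> Go z.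
Proof.
case: z => x y /nbhs_ballP[r /= r0 H].
have B (a b : R) : `|a| < r -> `|b| < r -> Gamma (x + a, y + b).
  move=> ar br; apply: H; rewrite -ball_normE /= prod_normE /= gt_max.
  by rewrite !opprD !addrA !subrr !add0r !normrN ar br.
have r2 : `|r / 2| < r by rewrite gtr0_norm; lra.
have r2N : `|- (r / 2)| < r by rewrite normrN gtr0_norm; lra.
have z0 : `|(0 : R)| < r by rewrite normr0.
(* Moving by half the radius towards each of the three sides turns the weak inequalities into strict
   ones. *)
have [/= h1 _ _] := B _ _ r2N z0; have [/= _ h2 _] := B _ _ z0 r2N.
have [/= _ _ h3] := B _ _ r2 r2.
by split => /=; lra.
Qed.

Lemma continuous_emap e : continuous (emap e).
Proof. by rewrite emap_affmap; exact: continuous_affmap. Qed.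

(** A neighbourhood inside the element pulls back, by continuity of [emap e], to one inside
    [Gamma]. *)
Lemma interior_elt e : interior (elt e) = img e.
Proof.
apply/seteqP; split => z; last first.
  move=> iz; have nz := open_nbhs_nbhs (conj (@img_open e) iz).
  exact: (filterS (@img_elt e) nz).
rewrite /interior /= => nz.
have K : nbhs (inve e z) (emap e @^-1` elt e).
  by have := @continuous_emap e (inve e z); rewrite /continuous_at emap_affinvK; apply.
have G : emap e @^-1` elt e `<=` Gamma.
  by move=> w [w' Gw'] /(congr1 (inve e)); rewrite !affinv_emapK => <-.
exact: (interior_Gamma (filterS G K)).
Qed.

Lemma elt_closed e : closed (elt e).
Proof.
have -> : elt e = inve e @^-1` Gamma.
  apply/seteqP; split => z; first by move=> [w Gw <-]; rewrite /preimage /= affinv_emapK.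
  by move=> G; exists (inve e z) => //; rewrite emap_affinvK.
have ci : continuous (inve e) by apply: continuous_affinv; exact: edet_neq0.
have c1 : continuous (fst : plane R -> R) by move=> z; exact: cvg_fst.
have c2 : continuous (snd : plane R -> R) by move=> z; exact: cvg_snd.
have -> : Gamma = (fst @^-1` [set t : R | 0 <= t] `&` snd @^-1` [set t : R | 0 <= t]) `&`
    (fun z : plane R => z.1 + z.2) @^-1` [set t : R | t <= 1].
  by apply/seteqP; split => [z [? ? ?]|z [[? ?] ?]].
have cs : continuous (fun z : plane R => z.1 + z.2).
  by move=> z; apply: cvgD; [exact: c1|exact: c2].
rewrite !preimage_setI; apply: closedI; first apply: closedI.
- apply: (@preimage_closed _ _ (fst \o inve e)); last exact: closed_ge.
  by move=> z _; apply: continuous_comp; [exact: ci|exact: c1].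
- apply: (@preimage_closed _ _ (snd \o inve e)); last exact: closed_ge.
  by move=> z _; apply: continuous_comp; [exact: ci|exact: c2].
- apply: (@preimage_closed _ _ ((fun z : plane R => z.1 + z.2) \o inve e)); last exact: closed_le.
  by move=> z _; apply: continuous_comp; [exact: ci|exact: cs].
Qed.

(* From the lower vertex of the edge to the vertex opposite to the edge. *)
Definition refopp j : plane R := [:: (1, 0); (0, 1); (0, -1)]`_j.

(** The opposite vertex lies to the left of the edge exactly when the edge runs counterclockwise;
    orientation signs thereby become statements about sides. *)
Lemma det2_refopp j : det2 (reftan j) (refopp j) = osign j.
Proof.
rewrite /det2; elim/I3P: j; rewrite ?reftan12 ?reftan13 ?reftan23 /refopp /osign /=; ring.
Qed.

(** [a] and [b] are the barycentric coordinates belonging to the upper end of the edge and to the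
    opposite vertex. *)
Lemma ref_halfplane j (a b : R) : 0 <= a -> 0 <= b -> a + b <= 1 ->
  Gamma (vert (elo j) + a *: reftan j + b *: refopp j).
Proof.
have v12 : vert (elo e12) = (0, 0) :> plane R by [].
have v13 : vert (elo e13) = (0, 0) :> plane R by [].
have v23 : vert (elo e23) = (0, 1) :> plane R by [].
move=> a0 b0 ab; elim/I3P: j; rewrite ?reftan12 ?reftan13 ?reftan23 ?v12 ?v13 ?v23 /refopp;
  split; rewrite /= /GRing.scale /=; lra.
Qed.

Lemma ref_off_edge j (a b : R) : 0 < b ->
  ~ edge j (vert (elo j) + a *: reftan j + b *: refopp j).
Proof.
have v12 : vert (elo e12) = (0, 0) :> plane R by [].
have v13 : vert (elo e13) = (0, 0) :> plane R by [].
have v23 : vert (elo e23) = (0, 1) :> plane R by [].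
move=> b0 [s _]; elim/I3P: j; rewrite ?reftan12 ?reftan13 ?reftan23 ?v12 ?v13 ?v23
  ?epar12 ?epar13 ?epar23 /refopp => /pair_equal_spec[] /=;
  rewrite /GRing.scale /= => ? ?; clear v12 v13 v23; lra.
Qed.

Definition physical e (w : plane R) : plane R := w.1 *: eu e + w.2 *: ev e.

Lemma det2_physical e w w' :
  det2 (physical e w) (physical e w') = edet e * det2 w w'.
Proof.
rewrite /physical /edet /det2 /=; case: (eu e) (ev e) w w' => u1 u2 [v1 v2] [a b] [c d] /=.
by rewrite /GRing.scale /=; ring.
Qed.

Lemma emap_physical e z w : emap e (z + w) = emap e z + physical e w.
Proof.
rewrite !emap_affmap /affmap /physical; apply/pair_equal_spec.
by split; rewrite /= /GRing.scale /=; ring.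
Qed.

Lemma physicalDZ e a b w w' :
  physical e (a *: w + b *: w') = a *: physical e w + b *: physical e w'.
Proof.
by rewrite /physical; apply/pair_equal_spec; split; rewrite /= /GRing.scale /=; ring.
Qed.

Lemma epar0 j : epar j (0 : R) = vert (elo j).
Proof. by rewrite /epar subr0 scale1r scale0r addr0. Qed.

Lemma cramer2 (x y z : plane R) : det2 x y != 0 ->
  z = (det2 z y / det2 x y) *: x + (det2 x z / det2 x y) *: y.
Proof.
case: x y z => x1 x2 [y1 y2] [z1 z2]; rewrite /det2 /= => D0.
by apply/pair_equal_spec; split; rewrite /= /GRing.scale /=; field.
Qed.

(* If the two elements lay on the same side of their common edge, a point
   near the midpoint of that edge would be common to both. *)
Lemma same_edge_opposite e j f k : e != f -> same_edge e j f k ->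
  ~ 0 < (edet e * osign j) * (edet f * osign k).
Proof.
move=> ef E H.
have P := @same_edge_par R m e j f k 0 E ltac:(by rewrite lexx ler01).
have Q := @same_edge_par R m e j f k 1 E ltac:(by rewrite lexx ler01).
rewrite !epar0 in P.
have e1 l : epar l (1 : R) = vert (elo l) + reftan l.
  by rewrite /epar subrr scale0r scale1r add0r /reftan addrC subrK.
rewrite !e1 !emap_physical -P in Q; move/addrI : Q => T.
move: H; rewrite -!det2_refopp -!det2_physical -T.
(* [t] is the common tangent, [n] and [o] point from the edge into the two elements; equal signs of
   the determinants mean the same side. *)
set t := physical e (reftan j); set n := physical e _; set o := physical f _ => H.
have tn : det2 t n != 0 by apply: contraTneq H => ->; rewrite mul0r ltxx.
(* Coordinates of [o] in the basis [t], [n]; lying on the same side is positivity of [be]. *)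
pose al := det2 o n / det2 t n; pose be := det2 t o / det2 t n.
have oE : o = al *: t + be *: n := cramer2 o tn.
have be0 : 0 < be.
  have -> : be = det2 t n * det2 t o / (det2 t n) ^+ 2 by rewrite /be; field.
  by rewrite divr_gt0// exprn_even_gt0.
(* With this choice [ep], [ep * |al|] and [ep * be] add up to 1/4, so that starting from the edge
   parameter 1/2 the point stays in both reference triangles. *)
pose ep := (4 * (1 + `|al| + be))^-1.
have S0 : 0 < 4 * (1 + `|al| + be) by have := normr_ge0 al; lra.
have ep0 : 0 < ep by rewrite invr_gt0.
have epS : ep * (1 + `|al| + be) = 4^-1.
  by rewrite /ep; field; have := normr_ge0 al; rewrite gt_eqF//; lra.
have [ea1 ea2] : - (ep * `|al|) <= ep * al /\ ep * al <= ep * `|al|.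
  by split; [rewrite -mulrN ler_pM2l// lerNnormlW|rewrite ler_pM2l// ler_norm].
have ee : 0 <= ep * `|al| by rewrite mulr_ge0// ltW.
have eb0 : 0 < ep * be by rewrite mulr_gt0.
rewrite !mulrDr mulr1 in epS.
have pt : emap f (vert (elo k) + 2^-1 *: reftan k + ep *: refopp k) =
    emap e (vert (elo j) + (2^-1 + ep * al) *: reftan j + (ep * be) *: refopp j).
  rewrite -!addrA !emap_physical !physicalDZ -P -T -/t -/n -/o oE.
  have L (x y : plane R) : 2^-1 *: x + ep *: (al *: x + be *: y) =
      (2^-1 + ep * al) *: x + (ep * be) *: y.
    by rewrite scalerDr !scalerA scalerDl addrA.
  by rewrite L.
have Gf : Gamma (vert (elo k) + 2^-1 *: reftan k + ep *: refopp k).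
  by apply: ref_halfplane; lra.
have Ge : Gamma (vert (elo j) + (2^-1 + ep * al) *: reftan j + (ep * be) *: refopp j).
  by apply: ref_halfplane; lra.
have : (emap e @` Gamma `&` emap f @` Gamma)
    (emap e (vert (elo j) + (2^-1 + ep * al) *: reftan j + (ep * be) *: refopp j)).
  by split; [exists (vert (elo j) + (2^-1 + ep * al) *: reftan j + (ep * be) *: refopp j)|
    rewrite -pt; exists (vert (elo k) + 2^-1 *: reftan k + ep *: refopp k)].
rewrite (same_edge_meet ef E) => -[w Ew /emap_inj we].
by apply: (@ref_off_edge j (2^-1 + ep * al) _ eb0); rewrite -(we (edge_Gamma Ew) Ge); exact: Ew.
Qed.

Lemma epar_open_edge j l (s : R) : 0 < s < 1 -> edge l (epar j s) -> j = l.
Proof.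
move=> /andP[s0 s1] [t _]; elim/I3P: j; elim/I3P: l => //;
  rewrite ?epar12 ?epar13 ?epar23 => /pair_equal_spec[? ?]; exfalso; lra.
Qed.

Lemma vert_Gamma i : Gamma (vert i : plane R).
Proof. by elim/I3P: i; split => /=; lra. Qed.

Lemma epar_not_vert j i (s : R) : 0 < s < 1 -> epar j s <> vert i.
Proof.
have v1 : vert e12 = (0, 0) :> plane R by [].
have v2 : vert e13 = (0, 1) :> plane R by [].
have v3 : vert e23 = (1, 0) :> plane R by [].
move=> /andP[s0 s1]; elim/I3P: j; elim/I3P: i; rewrite ?v1 ?v2 ?v3 ?epar12 ?epar13 ?epar23;
  move=> /pair_equal_spec[? ?]; clear v1 v2 v3; lra.
Qed.

(** If another element contains the point, [mesh_conf] makes the intersection an edge, since a point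
    inside an edge is no vertex. Otherwise the finitely many other elements, being closed, keep
    away, and the point would be interior to [e]. *)
Lemma interior_edge_shared e j s : 0 < s < 1 -> domain m (emap e (epar j s)) ->
  exists f k, f != e /\ same_edge e j f k.
Proof.
move=> s01 Apt; have s01' : 0 <= s <= 1 by case/andP: s01 => *; apply/andP; split; exact: ltW.
have Gpt := edge_Gamma (epar_edge j s01').
set pt := emap e (epar j s) in Apt *.
have [[f fe fpt]|nf] := pselect (exists2 f, f != e & elt f pt).
  have Ipt : (emap e @` Gamma `&` emap f @` Gamma) pt by split=> //; exists (epar j s).
  have ef : e != f by rewrite eq_sym.
  have [I0|[i [k [I1 _]]]|[l [k [I1 par]]]] := mesh_conf ef.
  - by rewrite I0 in Ipt.
  - exfalso; move: Ipt; rewrite I1 /= => Ei; apply: (@epar_not_vert j i _ s01).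
    exact: (emap_inj Gpt (vert_Gamma i) Ei).
  - have jl : j = l.
      move: Ipt; rewrite I1 => -[w lw wE]; apply: (@epar_open_edge _ _ _ s01).
      by rewrite -(emap_inj (edge_Gamma lw) Gpt wE).
    exists f, k; split=> //; rewrite jl; apply/asboolP/seteqP; split => _ [_ [t t01 <-] <-].
      by exists (epar k t); [exact: epar_edge|rewrite par].
    by exists (epar l t); [exact: epar_edge|rewrite -par].
exfalso.
have near_e : nbhs pt (elt e).
  have away f : nbhs pt [set z | f != e -> ~ elt f z].
    have [fe|fe] := pselect (f = e).
      have sub : setT `<=` [set z | f != e -> ~ elt f z] by move=> z _; rewrite /= fe eqxx.
      exact: (filterS sub filterT).
    have {}fe : f != e by apply/eqP.
    have nz : (~` elt f) pt by move=> H; apply: nf; exists f.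
    have o : open (~` elt f) by apply: closed_openC; exact: elt_closed.
    have sub : ~` elt f `<=` [set z | f != e -> ~ elt f z] by move=> z nfz _.
    exact: (filterS sub (open_nbhs_nbhs (conj o nz))).
  have H : nbhs pt [set z | forall f, f != e -> ~ elt f z].
    exact: (@filter_forall _ _ (fun f => [set z | f != e -> ~ elt f z]) (nbhs pt) _ away).
  have A : nbhs pt [set z | exists f, elt f z] := Apt.
  have sub : [set z | exists f, elt f z] `&` [set z | forall f, f != e -> ~ elt f z] `<=` elt e.
    by move=> z [[f fz] nz]; have [<-//|/nz] := eqVneq f e.
  exact: (filterS sub (filterI A H)).
have : interior (elt e) pt := near_e.
rewrite interior_elt /Goimg /preimage /= affinv_emapK.
exact: edge_Go_disjoint (epar_edge j s01').
Qed.

End AffineMesh.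

(** * The weak curl on affine meshes *)

Section AffineConformity.
Context {R : realType} (m : mesh R).
Hypothesis haff : affine_mesh m.
Implicit Types (e f : 'I_(nelem m)) (j k : 'I_3).
Notation muP := (@mu2 R).
Notation mu := (@lebesgue_measure R).
Notation inve e := (affinv (eb e) (eu e) (ev e)).
Notation img e := (Goimg (eb e) (eu e) (ev e)).

(** The pairings with the images of the two axis directions determine the vector; solving them is
    Cramer's rule. *)
Lemma piola_img e (th : vfield R) z : img e z -> let w := th (inve e z) in
  piola e th z = vec2 (((ev e).2 * w 0 0 - (eu e).2 * w 1 0) / edet e)
                      (((eu e).1 * w 1 0 - (ev e).1 * w 0 0) / edet e).
Proof.
move=> iz w; have D0 := edet_neq0 haff e.
have G := Go_Gamma iz.
have E t : dot (vec (physical e t)) (piola e th z) = dot (vec t) w.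
  rewrite /piola (einv_img haff iz) /physical -(jacobian_mulmx haff e t G).
  by rewrite dot_adjoint// emap_unit.
have E0 := E (1, 0); have E1 := E (0, 1).
rewrite [LHS]vec2_eta; move: (piola e th z) E0 E1 D0 => P.
rewrite !dotE /vec !vec2E /physical /edet /det2 /=; case: (eu e) (ev e) => a b [c d] /=.
rewrite /GRing.scale /= !mul1r !mul0r !addr0 !add0r => <- <- D0.
by congr vec2; field.
Qed.

Lemma img_domain e : img e `<=` domain m.
Proof.
move=> z iz; have n := open_nbhs_nbhs (conj (@img_open _ _ haff e) iz).
have sub : img e `<=` [set z | exists f, elt f z] by move=> w /(img_elt haff) ew; exists e.
exact: (filterS sub n).
Qed.

Lemma domain_measurable :
  measurable (domain m : set (measurableTypeR R * measurableTypeR R)).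
Proof. exact: (open_measurable_plane (@open_interior _ _)). Qed.

(** On each open element this is [G e] read through the inverse element map; off the open elements
    it is zero, as [plane_field] is. *)
Definition piecewise (G : 'I_(nelem m) -> plane R -> R) (z : plane R) : R :=
  \sum_e ((G e \o inve e) \_ (img e)) z.

Lemma piecewise_in_L2 (G : 'I_(nelem m) -> plane R -> R) :
  (forall e, continuous (G e)) -> in_L2 (domain m) (piecewise G).
Proof.
move=> cG; rewrite /in_L2.
have -> : piecewise G \_ (domain m) = \sum_e ((G e \o inve e) \_ (img e)).
  apply/funext => z; rewrite patchE fct_sumE; case: ifPn => // /negP nz.
  rewrite big1// => e _; rewrite patchE ifF//; apply/negP => /set_mem iz; apply: nz.
  exact/mem_set/(@img_domain e).
have p1 : (1 <= 2%:E :> \bar R)%E by rewrite lee_fin ler1n.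
have [L0 LD] := Lfun_addr_closed muP p1.
elim/big_ind: _ => [|f g|e _]; [exact: L0|exact: LD|].
by apply: Goimg_Lfun2; [exact: edet_neq0|exact: cG].
Qed.

Lemma integral_piecewise (G : 'I_(nelem m) -> plane R -> R) :
  (forall e, continuous (G e)) ->
  \int[muP]_(z in domain m) piecewise G z =
  \sum_e `|edet e| * \int[muP]_(z in Go) G e z.
Proof.
move=> cG; rewrite /piecewise Rintegral_sum_patch.
- by apply: eq_bigr => e _; rewrite (integral_Goimg _ (edet_neq0 haff e)).
- exact: domain_measurable.
- by move=> e; apply: Goimg_measurable; exact: edet_neq0.
- exact: img_domain.
- by move=> e; apply: Goimg_integrable; [exact: edet_neq0|exact: cG].
Qed.

Lemma piecewise_eq (G : 'I_(nelem m) -> plane R -> R) (F : 'I_(nelem m) -> plane R -> R) z :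
  (forall e, img e z -> F e z = G e (inve e z)) ->
  \sum_e (if `[< img e z >] then F e z else 0) = piecewise G z.
Proof.
move=> H; apply: eq_bigr => e _; rewrite patchE.
case: asboolP => iz; last by rewrite ifF//; apply/negP => /set_mem.
by rewrite ifT ?H//; exact/mem_set.
Qed.

Lemma piecewise_mul (G : 'I_(nelem m) -> plane R -> R) (phi : plane R -> R) z :
  piecewise G z * phi z = piecewise (fun e => G e \* (phi \o emap e)) z.
Proof.
rewrite /piecewise mulr_suml; apply: eq_bigr => e _; rewrite !patchE.
by case: ifP => _; rewrite /= ?mul0r// (emap_affinvK haff).
Qed.

Lemma piecewiseB (G H : 'I_(nelem m) -> plane R -> R) z :
  piecewise G z - piecewise H z = piecewise (fun e => G e \- H e) z.
Proof.
rewrite /piecewise -sumrB; apply: eq_bigr => e _; rewrite !patchE.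
by case: ifP => _; rewrite //= subrr.
Qed.

Context (v : 'I_(nelem m) -> vfield R).
Hypothesis vs : forall e, smooth_field (v e).
Hypothesis vt : forall f k f' k' s, same_edge f k f' k' -> 0 <= s <= 1 ->
  rtrace k (v f) s = rtrace k' (v f') s.

Let w0 e z := v e z 0 0.
Let w1 e z := v e z 1 0.

(** The integral over the parameter carries no length element because [rtrace] uses the unnormalized
    edge vector. *)
Definition edge_flux (phi : plane R -> R) (x : 'I_(nelem m) * 'I_3) : R :=
  \int[mu]_(s in `]0, 1[) (phi (emap x.1 (epar x.2 s)) * rtrace x.2 (v x.1) s).

(** The sign of the physical edge relative to the counterclockwise boundary of its element: a
    negative determinant reverses the sign of the reference edge. *)
Definition edge_sign (x : 'I_(nelem m) * 'I_3) : R := Num.sg (edet x.1 * osign x.2).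

Lemma osign_neq0 j : @osign R j != 0.
Proof. by elim/I3P: j; rewrite /osign /= ?oppr_eq0 oner_eq0. Qed.

Lemma edge_flux_sum (phi : plane R -> R) : test_function (domain m) phi ->
  \sum_x edge_sign x * edge_flux phi x = 0.
Proof.
move=> [_ [K [_ KA phi0]]].
pose nbr (x y : 'I_(nelem m) * 'I_3) := (y.1 != x.1) && same_edge x.1 x.2 y.1 y.2.
(* The default [x] makes an edge without a partner a fixed point, where the flux vanishes. *)
pose tau x := odflt x [pick y | nbr x y].
have sqr_sg_neq0 x : edge_sign x ^+ 2 = 1.
  by rewrite /edge_sign sqr_sg mulf_neq0 ?osign_neq0// (edet_neq0 haff).
have sign_nbr x y : nbr x y -> edge_sign y = - edge_sign x.
  move=> /andP[yx xy]; have H := same_edge_opposite haff _ xy; rewrite eq_sym in yx.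
  move/(_ yx)/negP : H; rewrite -leNgt => H.
  have neg : edet x.1 * osign x.2 * (edet y.1 * osign y.2) < 0.
    by rewrite lt_neqAle H andbT !mulf_neq0 ?osign_neq0// (edet_neq0 haff).
  have := ltr0_sg neg; rewrite sgrM -/(edge_sign x) -/(edge_sign y) => E.
  by rewrite -[edge_sign y]mul1r -(sqr_sg_neq0 x) expr2 -mulrA E mulrN1.
have flux_nbr x y : nbr x y -> edge_flux phi y = edge_flux phi x.
  move=> /andP[_ xy]; apply: eq_Rintegral => s; rewrite inE /= in_itv /= => /andP[s0 s1].
  have s01 : 0 <= s <= 1 by apply/andP; split; exact: ltW.
  by rewrite (same_edge_par xy s01) (vt xy s01).
have flux0 x : (forall y, ~~ nbr x y) -> edge_flux phi x = 0.
  move=> nx; rewrite /edge_flux /Rintegral integral0_eq// => s /=.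
  rewrite in_itv /= => s01; congr EFin.
  have [->|/eqP nz] := eqVneq (phi (emap x.1 (epar x.2 s))) 0; first by rewrite mul0r.
  have : domain m (emap x.1 (epar x.2 s)).
    by apply: KA; apply: contrapT => nK; apply: nz; exact: phi0.
  move=> /(interior_edge_shared haff s01)[f [k [fe E]]].
  by have := nx (f, k); rewrite /nbr /= fe E.
have sign_neq0 x : edge_sign x != 0.
  by rewrite sgr_eq0 mulf_neq0 ?osign_neq0// (edet_neq0 haff).
have tauP x : (nbr x (tau x)) \/ (tau x = x /\ forall y, ~~ nbr x y).
  rewrite /tau; case: pickP => [y ny|nn]; first by left.
  by right; split=> // y; rewrite nn.
have nbrC x y : nbr x y = nbr y x.
  by rewrite /nbr eq_sym same_edge_sym.
(* Three elements cannot share an edge, since their signs would be pairwise opposite; so the partner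
   of the partner is the original edge. *)
have tauK : involutive tau.
  move=> x; have [nx|[tx nn]] := tauP x; last by rewrite !tx.
  have [ny|[_ /(_ x)]] := tauP (tau x); last by rewrite nbrC nx.
  move: nx ny; set y := tau x; set z := tau y => nx ny.
  have /andP[_ xy] := nx; have /andP[_ yz] := ny.
  have [zx|zx] := eqVneq z.1 x.1.
    have E : same_edge x.1 x.2 z.1 z.2 by rewrite -(same_edge_trans _ _ yz).
    rewrite zx in E; move/same_edge_self : E => E.
    by rewrite [z]surjective_pairing [x]surjective_pairing zx E.
  have nz : nbr x z.
    by rewrite /nbr zx -(same_edge_trans _ _ yz).
  have := sign_nbr _ _ ny; rewrite (sign_nbr _ _ nx) (sign_nbr _ _ nz) opprK => /eqP.
  by rewrite eq_sym -addr_eq0 -mulr2n mulrn_eq0 /= (negPf (sign_neq0 x)).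
set S := \sum_x _.
have : S = - S.
  rewrite {1}/S (reindex_inj (inv_inj tauK)) /= /S -sumrN; apply: eq_bigr => x _.
  have [nx|[-> H]] := tauP x; last by rewrite flux0// mulr0 oppr0.
  by rewrite (sign_nbr _ _ nx) (flux_nbr _ _ nx) mulNr.
by move/eqP; rewrite -addr_eq0 -mulr2n mulrn_eq0 /= => /eqP.
Qed.

(** As [emap e] is affine, the difference quotients of the composite are those of [phi] along
    [physical e t]. *)
Lemma derive_comp_emap e (phi : plane R -> R) z t : C1 phi ->
  is_derive z t (phi \o emap e) ('D_(physical e t) phi (emap e z)).
Proof.
move=> phi1.
have E : (fun h : R => h^-1 *: (((phi \o emap e) \o shift z) (h *: t) - (phi \o emap e) z)) =
    (fun h => h^-1 *: ((phi \o shift (emap e z)) (h *: physical e t) - phi (emap e z))).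
  apply/funext => h /=; rewrite [h *: t + z]addrC (emap_physical haff).
  have -> : physical e (h *: t) = h *: physical e t.
    by rewrite /physical; apply/pair_equal_spec; split; rewrite /= /GRing.scale /=; ring.
  by rewrite [emap e z + _]addrC.
have D : derivable phi (emap e z) (physical e t).
  exact/diff_derivable/C1_differentiable.
split; first by rewrite /derivable E; exact: D.
by rewrite /derive E.
Qed.

Lemma C1_comp_emap e (phi : plane R -> R) : C1 phi ->
  [/\ C1 (phi \o emap e),
    dx (phi \o emap e) = fun z => (eu e).1 * dx phi (emap e z) + (eu e).2 * dy phi (emap e z) &
    dy (phi \o emap e) = fun z => (ev e).1 * dx phi (emap e z) + (ev e).2 * dy phi (emap e z)].
Proof.
move=> phi1.
have p10 : physical e (1, 0) = eu e by rewrite /physical /= scale1r scale0r addr0.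
have p01 : physical e (0, 1) = ev e by rewrite /physical /= scale1r scale0r add0r.
have Ex : dx (phi \o emap e) = fun z => (eu e).1 * dx phi (emap e z) + (eu e).2 * dy phi (emap e z).
  apply/funext => z; have D := derive_comp_emap e z (1, 0) phi1.
  by rewrite /dx (derive_val (is_derive := D)) p10 C1_derive.
have Ey : dy (phi \o emap e) = fun z => (ev e).1 * dx phi (emap e z) + (ev e).2 * dy phi (emap e z).
  apply/funext => z; have D := derive_comp_emap e z (0, 1) phi1.
  by rewrite /dy (derive_val (is_derive := D)) p01 C1_derive.
have [_ _ cx cy] := phi1.
have lin (a b : R) : continuous (fun z => a * dx phi (emap e z) + b * dy phi (emap e z)).
  move=> z; apply: cvgD; apply: cvgM; try exact: cvg_cst.
    by apply: (@continuous_comp _ _ _ (emap e) (dx phi)); [exact: continuous_emap|exact: cx].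
  by apply: (@continuous_comp _ _ _ (emap e) (dy phi)); [exact: continuous_emap|exact: cy].
split; [|exact: Ex|exact: Ey]; split.
- by move=> z; have D := derive_comp_emap e z (1, 0) phi1; apply: ex_derive.
- by move=> z; have D := derive_comp_emap e z (0, 1) phi1; apply: ex_derive.
- by rewrite Ex; exact: lin.
- by rewrite Ey; exact: lin.
Qed.

(** By the product rule the integrand is the reference curl of the pulled-back test function times
    [v e], divided by [edet e], so Green's formula on the reference triangle applies. *)
Lemma element_green e (phi : plane R -> R) : C1 phi ->
  `|edet e| * \int[muP]_(z in Go)
     ((dx (w1 e) z - dy (w0 e) z) / edet e * phi (emap e z)
      - (((ev e).2 * w0 e z - (eu e).2 * w1 e z) / edet e * dy phi (emap e z)
         - ((eu e).1 * w1 e z - (ev e).1 * w0 e z) / edet e * dx phi (emap e z)))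
  = \sum_j edge_sign (e, j) * edge_flux phi (e, j).
Proof.
move=> phi1; have D0 := edet_neq0 haff e.
have [psi1 Ex Ey] := C1_comp_emap e phi1; set psi := phi \o emap e in psi1 Ex Ey *.
have h0 : C1 (w0 e) := smooth_C1 (vs e).1.
have h1 : C1 (w1 e) := smooth_C1 (vs e).2.
have m0 := C1M psi1 h0; have m1 := C1M psi1 h1.
have [_ _ cx1 _] := m1; have [_ _ _ cy0] := m0.
transitivity (`|edet e| * \int[muP]_(z in Go)
    ((edet e)^-1 * (dx (psi \* w1 e) z - dy (psi \* w0 e) z))).
  congr (_ * _); apply: eq_Rintegral => z _.
  rewrite (dxM psi1 h1) (dyM psi1 h0) Ex Ey /psi /=.
  by field.
rewrite RintegralZl; [|exact: Go_measurable|]; last first.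
  by apply: Go_integrable => z; apply: cvgB; [exact: cx1|exact: cy0].
rewrite (reference_green m0 m1) mulrA.
(* The area factor is a modulus, while the curl brings in the signed determinant; their quotient is
   the orientation that enters [edge_sign]. *)
have -> : `|edet e| * (edet e)^-1 = Num.sg (edet e).
  have [p|n|/esym z] := ltgtP 0 (edet e); last by rewrite z eqxx in D0.
    by rewrite gtr0_norm// gtr0_sg// divff.
  by rewrite ltr0_norm// ltr0_sg// mulNr divff.
rewrite mulr_sumr; apply: eq_bigr => j _; rewrite mulrA; congr (_ * _).
  rewrite /edge_sign sgrM /=; congr (_ * _).
  by elim/I3P: j; rewrite /osign /= ?sgrN sgr1.
apply: eq_Rintegral => s _; rewrite /rtrace dotE /vec !vec2E /psi /= /w0 /w1; ring.
Qed.

Lemma weak_curl_piecewise (u : 'I_(nelem m) -> vfield R) :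
  (forall f z, u f z = piola f (v f) z) ->
  in_Hcurl (domain m) (plane_field u).
Proof.
move=> uE.
have c0 e : continuous (w0 e) by apply: smooth_continuous; case: (vs e).
have c1 e : continuous (w1 e) by apply: smooth_continuous; case: (vs e).
pose G0 e z := ((ev e).2 * w0 e z - (eu e).2 * w1 e z) / edet e.
pose G1 e z := ((eu e).1 * w1 e z - (ev e).1 * w0 e z) / edet e.
(* The candidate for the weak curl: on each element the reference curl divided by the Jacobian
   determinant. *)
pose K e z := (dx (w1 e) z - dy (w0 e) z) / edet e.
have lin (a b c : R) (f g : plane R -> R) : continuous f -> continuous g ->
    continuous (fun z => (a * f z - b * g z) / c).
  move=> cf cg z; apply: cvgM; last exact: cvg_cst.
  by apply: cvgB; apply: cvgM; [exact: cvg_cst|exact: cf|exact: cvg_cst|exact: cg].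
have cG0 e : continuous (G0 e) by exact: lin.
have cG1 e : continuous (G1 e) by exact: lin.
have cK e : continuous (K e).
  have [_ _ cx _] := smooth_C1 (vs e).2; have [_ _ _ cy] := smooth_C1 (vs e).1.
  move=> z; apply: cvgM; last exact: cvg_cst.
  by apply: cvgB; [exact: cx|exact: cy].
have field_if z i : plane_field u z i 0 =
    \sum_e (if `[< img e z >] then u e z i 0 else 0).
  rewrite /plane_field summxE; apply: eq_bigr => e _; rewrite (interior_elt haff).
  by case: ifP => // _; rewrite mxE.
have E0 : (fun z => plane_field u z 0 0) = piecewise G0.
  apply/funext => z; rewrite field_if; apply: (@piecewise_eq G0 (fun e z => u e z 0 0)) => e iz.
  by rewrite uE (piola_img _ iz) vec2E.
have E1 : (fun z => plane_field u z 1 0) = piecewise G1.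
  apply/funext => z; rewrite field_if; apply: (@piecewise_eq G1 (fun e z => u e z 1 0)) => e iz.
  by rewrite uE (piola_img _ iz) vec2E.
split; [by rewrite E0; exact: piecewise_in_L2|by rewrite E1; exact: piecewise_in_L2|].
exists (piecewise K); split; first exact: piecewise_in_L2.
move=> phi tphi; have phi1 : C1 phi by apply: smooth_C1; exact: tphi.1.
have [_ _ cdx cdy] := phi1; have cphi := C1_continuous phi1.
have ce e (f : plane R -> R) : continuous f -> continuous (f \o emap e).
  by move=> cf z; apply: continuous_comp; [exact: continuous_emap|exact: cf].
have cM (f g : plane R -> R) : continuous f -> continuous g -> continuous (f \* g).
  by move=> cf cg z; apply: cvgM; [exact: cf|exact: cg].
have cB (f g : plane R -> R) : continuous f -> continuous g -> continuous (f \- g).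
  by move=> cf cg z; apply: cvgB; [exact: cf|exact: cg].
pose H e := (G0 e \* (dy phi \o emap e)) \- (G1 e \* (dx phi \o emap e)).
have cH e : continuous (H e).
  by apply: cB; apply: cM; [exact: cG0|exact: ce|exact: cG1|exact: ce].
have cKp e : continuous (K e \* (phi \o emap e)) by apply: cM; [exact: cK|exact: ce].
transitivity (\int[muP]_(z in domain m) piecewise (fun e => K e \* (phi \o emap e)) z).
  by apply: eq_Rintegral => z _; exact: piecewise_mul.
transitivity (\int[muP]_(z in domain m) piecewise H z); last first.
  apply: eq_Rintegral => z _; rewrite -piecewiseB -!piecewise_mul.
  by rewrite -E0 -E1.
(* Elementwise, the difference of the two sides is the boundary term of [element_green]; these terms
   add up to zero over the mesh. *)
rewrite !integral_piecewise//; apply/subr0_eq; rewrite -sumrB.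
rewrite -[RHS](edge_flux_sum tphi).
rewrite (eq_bigr (fun e => \sum_j edge_sign (e, j) * edge_flux phi (e, j))).
  by rewrite pair_big; apply: eq_bigr => -[].
move=> e _; rewrite -(element_green e phi1) -mulrBr; congr (_ * _).
by rewrite -RintegralB//; [exact: Go_measurable|exact: Go_integrable|exact: Go_integrable].
Qed.

End AffineConformity.

Theorem theorem3p6 (R : realType) (p : nat) (hp : (1 <= p)%N)
    (U : h1_family R p) (U' : h1_family R p.+1)
    (hU : h1_basis U) (hU' : h1_basis U') :
  Hcurl_conforming (nedelec_I U U').
Proof.
move=> m; split=> [u Gu|haff u Gu].
  exact: admissible_no_jump (admissible_global hU hU' Gu).
have [v [uE vs vt]] := admissible_global hU hU' Gu.
exact: (weak_curl_piecewise haff vs vt uE).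
Qed.
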